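(* Let $a,b,k$ be integers with $b>a\ge 1$ and $k\ge 0$, and let $G$ be a connected graph of order $n\ge 2(b+a+k+2)(b+k+2)$ with minimum degree $\delta(G)\ge a+k$. If $\lambda(G)\ge \lambda(F_n^{a,b,k})$, then $G$ is a fractional $(a,b,k)$-critical graph, unless $G\cong F_n^{a,b,k}$.
   Context: All graphs are finite, simple and undirected. $\lambda(G)$ denotes the spectral radius (largest adjacency eigenvalue) of $G$. For positive integers $b\ge a$, a fractional $[a,b]$-factor of $G$ exists if there is a function $h:E(G)\to[0,1]$ with $a\le \sum_{e\ni v} h(e)\le b$ for every vertex $v$ (the sum over edges incident to $v$); the fractional $[a,b]$-factor is the spanning subgraph with edge set $\{e: h(e)>0\}$. A graph $G$ is fractional $(a,b,k)$-critical if for every set $X$ of $k$ vertices, $G-X$ has a fractional $[a,b]$-factor. $K_m$ is the complete graph, $\cup$ disjoint union, $\vee$ join, $(b+1)K_1$ the edgeless graph on $b+1$ vertices. $F_n^{a,b,k}$ is obtained from $K_{a+k}\vee\big(K_{n-(a+b+k+1)}\cup (b+1)K_1\big)$ by adding $a-1$ edges between one (fixed) vertex of $(b+1)K_1$ and $a-1$ vertices of $K_{n-(a+b+k+1)}$. *)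

(* Defs.v *)
From mathcomp Require Import all_boot all_order all_algebra.
From mathcomp Require Import all_classical all_reals.

Set Implicit Arguments.
Unset Strict Implicit.
Unset Printing Implicit Defensive.

Import Order.TTheory GRing.Theory Num.Theory.
Local Open Scope ring_scope.

Record sgraph (T : finType) := SGraph {
  adj :> rel T;
  adj_sym : symmetric adj;
  adj_irrefl : irreflexive adj
}.

Definition isomorphic (T U : finType) (G : sgraph T) (H : sgraph U) : Prop :=
  exists2 f : T -> U, bijective f & forall x y, G x y = H (f x) (f y).

Section Invariants.
Variables (T : finType) (G : sgraph T).

(* The empty graph counts as connected here. *)
Definition connected : Prop := forall x y : T, connect G x y.

Definition degree (v : T) : nat := #|[pred w | G v w]|.

(* Every degree is smaller than #|T|, so the default value #|T| matters only
   for the empty graph. *)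
Definition min_degree : nat := \big[minn/#|T|]_(v : T) degree v.

Definition edges : {set {set T}} :=
  [set e : {set T} | [exists x, [exists y, G x y && (e == [set x; y])]]]%SET.

Definition adjacency_mx (R : realType) : 'M[R]_#|T| :=
  \matrix_(i, j) (G (enum_val i) (enum_val j))%:R.

(* The matrix is real symmetric, so for nonempty T the set of its real
   eigenvalues is finite and nonempty, and this supremum is a maximum. *)
Definition spectral_radius (R : realType) : R :=
  sup [set x : R | eigenvalue (adjacency_mx R) x]%classic.

Definition has_fractional_factor (R : realType) (a b : nat) : Prop :=
  exists h : {set T} -> R,
    (forall e, e \in edges -> 0 <= h e <= 1) /\
    (forall v : T, a%:R <= \sum_(e in edges | v \in e) h e <= b%:R).

End Invariants.

Section Deletion.
Variables (T : finType) (G : sgraph T) (X : {set T}).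

Definition del_rel : rel {x : T | x \notin X} := fun x y => G (val x) (val y).

Lemma del_sym : symmetric del_rel.
Proof. by move=> x y; apply: adj_sym. Qed.

Lemma del_irrefl : irreflexive del_rel.
Proof. by move=> x; apply: adj_irrefl. Qed.

Definition delete_vertices : sgraph {x : T | x \notin X} :=
  SGraph del_sym del_irrefl.

End Deletion.

Definition fractional_critical (R : realType) (T : finType) (G : sgraph T)
    (a b k : nat) : Prop :=
  forall X : {set T}, #|X| = k ->
    has_fractional_factor (delete_vertices G X) R a b.

Section BasicGraphs.
Variable T : finType.

Lemma complete_sym : symmetric (fun x y : T => x != y).
Proof. by move=> x y; rewrite eq_sym. Qed.

Lemma complete_irrefl : irreflexive (fun x y : T => x != y).
Proof. by move=> x; rewrite eqxx. Qed.

Definition complete : sgraph T := SGraph complete_sym complete_irrefl.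

Definition edgeless : sgraph T :=
  @SGraph T (fun _ _ => false) (fun _ _ => erefl) (fun _ => erefl).

End BasicGraphs.

Section Sums.
Variables (T U : finType) (G : sgraph T) (H : sgraph U).

(* [cross] tells whether the vertices of G are adjacent to those of H. *)
Definition sum_rel (cross : bool) : rel (T + U) := fun x y =>
  match x, y with
  | inl x, inl y => G x y
  | inr x, inr y => H x y
  | _, _ => cross
  end.

Lemma sum_sym cross : symmetric (sum_rel cross).
Proof. by move=> [x|x] [y|y] //=; apply: adj_sym. Qed.

Lemma sum_irrefl cross : irreflexive (sum_rel cross).
Proof. by move=> [x|x] /=; apply: adj_irrefl. Qed.

Definition disjoint_union : sgraph (T + U)%type :=
  SGraph (sum_sym false) (sum_irrefl false).

Definition join : sgraph (T + U)%type :=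
  SGraph (sum_sym true) (sum_irrefl true).

End Sums.

Section AddEdges.
Variables (T : finType) (G : sgraph T) (r : rel T).

Definition add_rel : rel T :=
  fun x y => G x y || (x != y) && (r x y || r y x).

Lemma add_sym : symmetric add_rel.
Proof. by move=> x y; rewrite /add_rel adj_sym eq_sym orbC [r x y || _]orbC orbC. Qed.

Lemma add_irrefl : irreflexive add_rel.
Proof. by move=> x; rewrite /add_rel adj_irrefl eqxx. Qed.

Definition add_edges : sgraph T := SGraph add_sym add_irrefl.

End AddEdges.

(* The added edges join vertex 0 of the edgeless part to the vertices
   0, ..., a - 2 of the middle clique. The order is n and there are a - 1 added
   edges as soon as 1 <= a and a + b + k + 1 + (a - 1) <= n. *)
Definition F_graph (n a b k : nat) :
    sgraph ('I_(a + k) + ('I_(n - (a + b + k + 1)) + 'I_b.+1))%type :=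
  add_edges
    (join (complete 'I_(a + k))
          (disjoint_union (complete 'I_(n - (a + b + k + 1)))
                          (edgeless 'I_b.+1)))
    (fun x y => match x, y with
                | inr (inr i), inr (inl j) => (i == ord0) && (j < a.-1)%N
                | _, _ => false
                end).

(* Main.v *)
From mathcomp Require Import all_boot all_order all_algebra.
From mathcomp Require Import all_classical all_reals.
From mathcomp Require Import topology normedtype derive.
From mathcomp Require Import ring lra zify.
Require Import Defs.

(* If G is not critical, the residuals of a least-squares approximation of a
   fractional factor of some G - X single out disjoint sets S and U, of sizes j and t,
   with sum_U deg + b j < t (a + k + j). Since the minimum degree is at least a + k,
   t > b; for t >= b + 2 Hong's bound contradicts lambda(G) >= n - b - 2, the radius of
   a clique of F. For t = b + 1 complete G to a clique outside U and let y be a Perron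
   vector of the result H. For each u in U, lambda y_u is the sum of y over the
   neighbours of u. Redirect the neighbours of the vertices of U to the largest
   entries of y outside U, all surplus degree going to a single vertex, and recompute
   the entries of y on U from the new neighbourhoods: as the entries outside U are
   nearly equal and squares are superadditive, the Rayleigh form does not decrease, and
   stays equal only if nothing has changed. The redirected graph is F. *)

Set Implicit Arguments.
Unset Strict Implicit.
Unset Printing Implicit Defensive.

Import Order.TTheory GRing.Theory Num.Theory.
Import numFieldNormedType.Exports.
Local Open Scope ring_scope.

(** * Minimization over compact sets *)

Section Compactness.
Variables (R : realType) (I : finType).
Implicit Types (v : 'rV[R]_#|I|) (z : I -> R).

(** Functions on [I] are read as row vectors, for which compactness of boxes and the extreme value
    theorem are stated. *)
Definition fun_of_row v : I -> R := fun i => v ord0 (enum_rank i).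
Definition row_of_fun z : 'rV[R]_#|I| := \row_j z (enum_val j).

Lemma row_of_funK z : fun_of_row (row_of_fun z) = z.
Proof. by apply/funext => i; rewrite /fun_of_row mxE enum_rankK. Qed.

Lemma fun_of_row_continuous i : continuous (fun v => fun_of_row v i).
Proof. exact: coord_continuous. Qed.

(** Read in row vectors, [C] is a closed subset of the compact box of radius [B], so the extreme
    value theorem applies. *)
Lemma compact_argmin (C : set (I -> R)) (f : (I -> R) -> R) (B : R) :
    (C !=set0)%classic -> (forall z i, C z -> `|z i| <= B) ->
    closed [set v | C (fun_of_row v)]%classic -> continuous (f \o fun_of_row) ->
  exists2 z, C z & forall w, C w -> f z <= f w.
Proof.
move=> [z0 Cz0] bC cC cf.
have [|||v] := @EVT_min_rV R _ (f \o fun_of_row) [set v | C (fun_of_row v)]%classic.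
- by exists (row_of_fun z0); rewrite /= row_of_funK.
- have cbox : compact [set v : 'rV[R]_#|I| | forall j, `[- B, B]%classic (v ord0 j)]%classic.
    by apply: (@rV_compact R _ (fun=> `[- B, B]%classic)) => j; apply: segment_compact.
  apply: (subclosed_compact cC cbox).
  move=> v Cv j /=; rewrite -(enum_valK j) in_itv /= -ler_norml.
  exact: (bC _ (enum_val j) Cv).
- by apply: continuous_subspaceT.
rewrite inE /= => Cv vmin; exists (fun_of_row v) => // w Cw.
have := vmin (row_of_fun w); rewrite /= row_of_funK; apply.
by rewrite inE /= row_of_funK.
Qed.

Lemma sum_continuous (K : finType) (F : K -> 'rV[R]_#|I| -> R) :
  (forall k, continuous (F k)) -> continuous (fun v => \sum_k F k v).
Proof.
move=> cF v; apply: (@cvg_big R K +%R 0 xpredT _ _ (nbhs v)).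
- exact: add_continuous.
- by move=> k _; exact: cF.
Qed.

End Compactness.

(** * Least squares over a box *)

Section BoxLeastSquares.
Variables (R : realType) (I J : finType) (c : J -> I -> R) (l u : I -> R).
Hypothesis lu : forall i, l i <= u i.

Let L (z : I -> R) j := \sum_i c j i * z i.

(** These are the first-order conditions at a minimizer of the sum of squares of [L z] over the box:
    [\sum_j L z j * c j i] is half the partial derivative in [z i], so it can be positive only at
    the lower end and negative only at the upper end. *)
Lemma box_least_squares : exists z : I -> R,
  [/\ forall i, l i <= z i <= u i,
      forall i, 0 < \sum_j L z j * c j i -> z i = l i
    & forall i, \sum_j L z j * c j i < 0 -> z i = u i].
Proof.
pose C := [set z : I -> R | forall i, l i <= z i <= u i]%classic.
pose f z := \sum_j L z j ^+ 2.
have [||||z Cz zmin] := @compact_argmin R I C f (\sum_i (`|l i| + `|u i|)).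
- by exists l => i; rewrite lexx lu.
- move=> z i Cz; rewrite (bigD1 i) //= -[leLHS]addr0 lerD ?sumr_ge0 //; last first.
    by move=> k _; rewrite addr_ge0.
  by have := Cz i; case: (ger0P (l i)); case: (ger0P (u i)); case: (ger0P (z i)); lra.
- rewrite (_ : mkset _ = \bigcap_(i in setT)
     ((fun v => fun_of_row v i) @^-1` `[l i, u i]))%classic; last first.
    apply/seteqP; split=> v /=; first by move=> Cv i _; rewrite /= in_itv; exact: Cv.
    by move=> Cv i; have := Cv i Logic.I; rewrite /= in_itv.
  apply: closed_bigI => i _; apply: preimage_closed; last exact: interval_closed.
  by move=> v _; apply: fun_of_row_continuous.
- apply: sum_continuous => j.
  have cL : continuous (fun v => L (fun_of_row v) j).
    apply: sum_continuous => i.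
    by move=> v; exact: (cvgM (cvg_cst _) (@fun_of_row_continuous _ _ i v)).
  by move=> v; exact: (cvgM (cL v) (cL v)).
pose S i := \sum_j L z j * c j i.
(* Along one coordinate the objective is a quadratic polynomial in the step. *)
have fstep i t : f (fun k => z k + t * (k == i)%:R) =
    f z + (2 * S i) * t + (\sum_j c j i ^+ 2) * t ^+ 2.
  have Ls j : L (fun k => z k + t * (k == i)%:R) j = L z j + t * c j i.
    rewrite /L; under eq_bigr do rewrite mulrDr.
    rewrite big_split /=; congr (_ + _); rewrite (bigD1 i) //= eqxx big1 ?addr0 ?mulr1; first by rewrite mulrC.
    by move=> k /negbTE ->; rewrite !mulr0.
  rewrite /f /S; under eq_bigr do rewrite Ls sqrrD.
  rewrite !big_split /=; congr (_ + _ + _).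
    by rewrite mulrAC [RHS]mulr_sumr -big_split /=; apply: eq_bigr => j _; ring.
  by rewrite [RHS]mulr_suml; apply: eq_bigr => j _; ring.
have K0 i : 0 <= \sum_j c j i ^+ 2 by rewrite sumr_ge0 // => j _; exact: sqr_ge0.
have Cstep i t : l i <= z i + t <= u i ->
    0 <= (2 * S i) * t + (\sum_j c j i ^+ 2) * t ^+ 2.
  move=> zt; have /zmin : C (fun k => z k + t * (k == i)%:R).
    move=> k /=; have [->|_] := eqVneq k i; first by rewrite mulr1.
    by rewrite mulr0 addr0; exact: Cz.
  by rewrite fstep; lra.
(* A step this short stays in the box and keeps the quadratic term below the linear one, so it would
   decrease the objective. *)
have small (K s r : R) : 0 <= K -> 0 < s -> 0 < r ->
    exists2 t, 0 < t <= r & K * t < s.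
  move=> K_ge0 s0 r0; have K1 : 0 < K + 1 by lra.
  exists (Num.min r (s / (K + 1))).
    by rewrite lt_min r0 divr_gt0 //= ge_min lexx.
  have : Num.min r (s / (K + 1)) <= s / (K + 1) by rewrite ge_min lexx orbT.
  rewrite ler_pdivlMr // => le_s.
  have : 0 < Num.min r (s / (K + 1)) by rewrite lt_min r0 divr_gt0.
  by lra.
exists z; split=> // i Si; have /andP[lz zu] := Cz i; apply/eqP.
  rewrite eq_le lz andbT leNgt; apply/negP => ltz.
  have [|t /andP[t0 tle] Kt] := small _ (S i) (z i - l i) (K0 i) Si; first by lra.
  have /Cstep : l i <= z i + - t <= u i by lra.
  have := mulr_gt0 t0 Si; rewrite -/(S i).
  have : 0 < t * (S i - (\sum_j c j i ^+ 2) * t) by rewrite mulr_gt0 //; lra.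
  by lra.
rewrite eq_le zu /= leNgt; apply/negP => ltz.
have [||t /andP[t0 tle] Kt] := small _ (- S i) (u i - z i) (K0 i); [by rewrite oppr_gt0|by lra|].
have /Cstep : l i <= z i + t <= u i by lra.
have : 0 < t * (- S i - (\sum_j c j i ^+ 2) * t) by rewrite mulr_gt0 //; lra.
have : 0 < t * (- S i) by rewrite mulr_gt0 ?oppr_gt0.
by lra.
Qed.

End BoxLeastSquares.

(** * The obstruction to fractional factors *)

Section FractionalFactors.
Variables (T : finType) (G : sgraph T).

Lemma big_edges_at (R : realType) (F : {set T} -> R) v :
  \sum_(e in edges G | v \in e) F e = \sum_(w | G v w) F [set v; w]%SET.
Proof.
have inj_v : {in [set w | G v w]%SET &, injective (fun w => [set v; w]%SET)}.
  move=> x y; rewrite !inE => vx vy /setP/(_ x); rewrite !inE eqxx orbT.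
  by have [xv|] := eqVneq x v; [rewrite xv adj_irrefl in vx | move=> _ /esym/eqP].
transitivity (\sum_(w in [set w | G v w]%SET) F [set v; w]%SET); last first.
  by apply: eq_bigl => w; rewrite inE.
rewrite -(big_imset _ inj_v) /=.
apply: eq_bigl => e; apply/andP/imsetP => [[]|[w]].
  rewrite inE => /existsP[x /existsP[y /andP[xy /eqP ->]]].
  rewrite !inE => /orP[]/eqP->; first by exists y; rewrite ?inE.
  by exists x; rewrite ?inE 1?adj_sym // finset.setUC.
rewrite inE => vw ->; rewrite !inE eqxx; split=> //.
by apply/existsP; exists v; apply/existsP; exists w; rewrite vw eqxx.
Qed.

(* A least-squares approximation of a feasible point: the vertices with extreme
   residual form the two sets of the obstruction. *)
Lemma fractional_factor_obstruction (R : realType) (a b : nat) :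
    (a <= b)%N -> ~ has_fractional_factor G R a b ->
  exists S U : {set T}, [disjoint S & U] /\
    (b * #|S| + \sum_(v in U) #|[set w | G v w & w \notin S]%SET| < a * #|U|)%N.
Proof.
move=> ab nofactor.
(* The unknowns are edge weights in [0, 1] and a target in [a, b] for each vertex. The form [c v] is
   the target minus the actual sum at [v], so a factor exists as soon as all these residuals
   vanish. *)
pose c (v : T) (i : {set T} + T) : R := match i with
  | inl e => - ((e \in edges G) && (v \in e))%:R
  | inr w => (v == w)%:R end.
pose l (i : {set T} + T) : R := if i is inl _ then 0 else a%:R.
pose u (i : {set T} + T) : R := if i is inl _ then 1 else b%:R.
have lu i : l i <= u i by case: i => //= _; rewrite ?ler01 ?ler_nat.
have [z [zlu zl zu]] := box_least_squares c lu.
pose x v w := z (inl [set v; w]%SET).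
pose h v := \sum_(w | G v w) x v w.
pose p v := \sum_i c v i * z i.
have pE v : p v = z (inr v) - h v.
  rewrite /p big_sumType /= addrC; congr (_ + _).
    rewrite (bigD1 v) //= eqxx mul1r big1 ?addr0 // => w /negbTE.
    by rewrite eq_sym => ->; rewrite mul0r.
  rewrite /h /x -(big_edges_at (fun e => z (inl e))) -sumrN [RHS]big_mkcond /=.
  apply: eq_bigr => e _; case: ifP => _; last by rewrite oppr0 mul0r.
  by rewrite mulNr mul1r.
have s_edge v w : G v w -> \sum_j p j * c j (inl [set v; w]%SET) = - (p v + p w).
  move=> vw; have vNw : w != v by apply: contraTneq vw => ->; rewrite adj_irrefl.
  have e_vw : [set v; w]%SET \in edges G.
    by rewrite inE; apply/existsP; exists v; apply/existsP; exists w; rewrite vw eqxx.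
  rewrite (bigD1 v) //= (bigD1 w) //= big1 => [|k /andP[kv kw]].
    by rewrite e_vw !inE !eqxx !orbT /=; ring.
  by rewrite e_vw !inE (negbTE kv) (negbTE kw) oppr0 mulr0.
have s_vertex v : \sum_j p j * c j (inr v) = p v.
  rewrite (bigD1 v) //= eqxx mulr1 big1 ?addr0 // => k /negbTE ->.
  by rewrite mulr0.
have x_sym v w : x v w = x w v by rewrite /x finset.setUC.
(* Optimality forces the weight of every edge whose two end residuals do not cancel. *)
have x_pos v w : G v w -> 0 < p v + p w -> x v w = 1.
  by move=> vw pvw; apply: (zu (inl _)); rewrite s_edge // oppr_lt0.
have x_neg v w : G v w -> p v + p w < 0 -> x v w = 0.
  by move=> vw pvw; apply: (zl (inl _)); rewrite s_edge // oppr_gt0.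
have h_pos v : 0 < p v -> h v < a%:R.
  by move=> pv; have := zl (inr v); rewrite s_vertex => /(_ pv) /= <-; rewrite -subr_gt0 -pE.
have h_neg v : p v < 0 -> b%:R < h v.
  by move=> pv; have := zu (inr v); rewrite s_vertex => /(_ pv) /= <-; rewrite -subr_lt0 -pE.
have [v0 pv0|p0] := pickP (fun v => p v != 0); last first.
  case: nofactor; exists (fun e => z (inl e)); split; first by move=> e _; exact: (zlu (inl e)).
  move=> v; rewrite big_edges_at -/(h v).
  have := p0 v => /negbFE; rewrite pE subr_eq0 => /eqP <-.
  exact: (zlu (inr v)).
case: (arg_maxP (fun v => `|p v|) (erefl : xpredT v0)) => m _ pmax.
set t := `|p m|.
have t0 : 0 < t by apply: lt_le_trans (pmax v0 isT); rewrite normr_gt0.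
have pt v : - t <= p v <= t by rewrite -ler_norml; exact: pmax.
pose S := [set v | p v == - t]%SET; pose U := [set v | p v == t]%SET.
have SU v : v \in S -> v \in U -> false.
  by rewrite !inE => /eqP-> /eqP; lra.
exists S, U; split.
  by apply/pred0P => v /=; apply/negP => /andP[vS vU]; have := SU _ vS vU.
pose q v := #|[set w | G v w & w \notin S]%SET|.
pose y v := \sum_(w in S | G v w) x v w.
(* Edges from [U] to the outside of [S] have positive residual sum, hence weight 1; edges from [S]
   to the outside of [U] have weight 0. So [S] sends weight only to [U], and the weight between them
   can be counted from either side. *)
have hU v : v \in U -> h v = y v + (q v)%:R.
  move=> vU; rewrite /h (bigID (mem S)) /=; congr (_ + _).
    by rewrite /y; apply: eq_bigl => w; rewrite andbC.
  rewrite (eq_bigr (fun=> 1)) => [|w /andP[vw wS]].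
    by rewrite sumr_const /q; congr (1 *+ _); apply: eq_card => w; rewrite [RHS]inE.
  apply: x_pos => //; move: vU wS; rewrite !inE => /eqP -> wS.
  by have := pt w; have : p w != - t by []; lra.
have hS v : v \in S -> h v = \sum_(w in U | G w v) x w v.
  move=> vS; rewrite /h (bigID (mem U)) /= [X in _ + X]big1 => [|w /andP[vw wU]].
    rewrite addr0; apply: eq_big => w; first by rewrite andbC adj_sym.
    by move=> _; exact: x_sym.
  apply: x_neg => //; move: vS wU; rewrite !inE => /eqP -> wU.
  by have := pt w; have : p w != t by []; lra.
have swap : \sum_(v in S) h v = \sum_(v in U) y v.
  rewrite (eq_bigr _ hS) /y; under eq_bigr do rewrite big_mkcondr /=.
  under [RHS]eq_bigr do rewrite big_mkcondr /=.
  by rewrite exchange_big.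
have leU : \sum_(v in U) h v <= (a * #|U|)%:R.
  rewrite natrM mulr_natr -sumr_const; apply: ler_sum => v; rewrite inE => /eqP pv.
  by apply/ltW/h_pos; rewrite pv.
have leS : (b * #|S|)%:R <= \sum_(v in S) h v.
  rewrite natrM mulr_natr -sumr_const; apply: ler_sum => v; rewrite inE => /eqP pv.
  by apply/ltW/h_neg; rewrite pv oppr_lt0.
have sumU : \sum_(v in U) h v = \sum_(v in U) y v + (\sum_(v in U) q v)%:R.
  by rewrite (eq_bigr _ hU) big_split /= natr_sum.
rewrite -/q -(ltr_nat R) natrD.
(* Every single term of the two estimates is strict; the vertex [m] shows that one of the two sets
   is nonempty. *)
suff [] : \sum_(v in U) h v < (a * #|U|)%:R \/ (b * #|S|)%:R < \sum_(v in S) h v by lra.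
have : (m \in U) || (m \in S).
  by rewrite !inE /t; case: (ger0P (p m)) => pm; rewrite ?opprK eqxx ?orbT.
case/orP=> [mU|mS]; [left|right].
  rewrite natrM mulr_natr -sumr_const (bigD1 m) //= [ltRHS](bigD1 m) //=.
  apply: ltr_leD; first by apply: h_pos; move: mU; rewrite inE => /eqP ->.
  apply: ler_sum => v /andP[]; rewrite inE => /eqP pv _.
  by apply/ltW/h_pos; rewrite pv.
rewrite natrM mulr_natr -sumr_const (bigD1 m) //= [ltRHS](bigD1 m) //=.
apply: ltr_leD; first by apply: h_neg; move: mS; rewrite inE => /eqP ->; rewrite oppr_lt0.
apply: ler_sum => v /andP[]; rewrite inE => /eqP pv _.
by apply/ltW/h_neg; rewrite pv oppr_lt0.
Qed.

End FractionalFactors.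

(** * Spectral radius *)

Section SpectralRadius.
Variables (R : realType) (T : finType) (G : sgraph T).
Implicit Types z w : T -> R.

(** With A the adjacency matrix, these three are A z, z^T z and z^T A z, indexed by vertices rather
    than by ordinals. *)
Definition nbsum z (x : T) : R := \sum_(y | G x y) z y.
Definition sqnorm z : R := \sum_x z x ^+ 2.
Definition qform z : R := \sum_x z x * nbsum z x.

Lemma nbsum_sym z w : \sum_x z x * nbsum w x = \sum_x w x * nbsum z x.
Proof.
rewrite /nbsum; under eq_bigr do rewrite mulr_sumr big_mkcond /=.
under [RHS]eq_bigr do rewrite mulr_sumr big_mkcond /=.
rewrite exchange_big /=; apply: eq_bigr => x _; apply: eq_bigr => y _.
by rewrite adj_sym mulrC.
Qed.

Lemma nbsumDZ z w t x : nbsum (fun y => z y + t * w y) x = nbsum z x + t * nbsum w x.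
Proof. by rewrite /nbsum big_split /= mulr_sumr. Qed.

Lemma qformDZ z w t : qform (fun x => z x + t * w x) =
  qform z + 2 * t * \sum_x w x * nbsum z x + t ^+ 2 * qform w.
Proof.
have -> : 2 * t * \sum_x w x * nbsum z x =
    t * (\sum_x w x * nbsum z x) + t * (\sum_x z x * nbsum w x).
  by rewrite (nbsum_sym z w); ring.
rewrite /qform !mulr_sumr -!big_split /=; apply: eq_bigr => x _.
by rewrite nbsumDZ; ring.
Qed.

Lemma sqnormDZ z w t : sqnorm (fun x => z x + t * w x) =
  sqnorm z + 2 * t * \sum_x w x * z x + t ^+ 2 * sqnorm w.
Proof.
rewrite /sqnorm !mulr_sumr -!big_split /=; apply: eq_bigr => x _; ring.
Qed.

Lemma qformZ t z : qform (fun x => t * z x) = t ^+ 2 * qform z.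
Proof.
rewrite /qform mulr_sumr; apply: eq_bigr => x _.
by rewrite /nbsum -mulr_sumr; ring.
Qed.

Lemma sqnormZ t z : sqnorm (fun x => t * z x) = t ^+ 2 * sqnorm z.
Proof. by rewrite /sqnorm mulr_sumr; apply: eq_bigr => x _; ring. Qed.

Lemma sqnorm_ge0 z : 0 <= sqnorm z.
Proof. by apply: sumr_ge0 => x _; exact: sqr_ge0. Qed.

Lemma sqnorm_gt0 z x : z x != 0 -> 0 < sqnorm z.
Proof.
move=> zx; rewrite /sqnorm (bigD1 x) //= ltr_wpDr ?sumr_ge0 //.
  by move=> y _; exact: sqr_ge0.
by rewrite exprn_even_gt0.
Qed.

Lemma qform_eigen z r : (forall x, nbsum z x = r * z x) -> qform z = r * sqnorm z.
Proof.
by move=> Az; rewrite /qform /sqnorm mulr_sumr; apply: eq_bigr => x _; rewrite Az; ring.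
Qed.

(** A vector at which the form reaches its upper bound is a critical point: changing its entry at
    [x] alone brings no first-order gain, which is the eigenvalue equation at [x]. *)
Lemma qform_max_eigen r z : (forall w, qform w <= r * sqnorm w) ->
  r * sqnorm z <= qform z -> forall x, nbsum z x = r * z x.
Proof.
move=> rmax zmax x; pose d y : R := (y == x)%:R.
have dE (F : T -> R) : \sum_y d y * F y = F x.
  rewrite (bigD1 x) //= /d eqxx mul1r big1 ?addr0 // => y /negbTE ->.
  by rewrite mul0r.
have qd : qform d = 0.
  rewrite /qform dE /nbsum big1 // => y xy; rewrite /d.
  by have [yx|//] := eqVneq y x; rewrite yx adj_irrefl in xy.
have nd : sqnorm d = 1 by rewrite /sqnorm dE /d eqxx.
have step t : 0 <= 2 * t * (r * z x - nbsum z x) + r * t ^+ 2.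
  have := rmax (fun y => z y + t * d y).
  by rewrite qformDZ sqnormDZ !dE qd nd; lra.
(* Adding two opposite steps cancels the linear term. *)
have r0 : 0 <= r by have := step 1; have := step (-1); lra.
set s := r * z x - nbsum z x in step.
apply/eqP; rewrite eq_sym -subr_eq0 -/s; apply/negP => /negP s0.
(* This step gives the value [- s^2 (r + 2) / (r + 1)^2]; dividing by [r + 1] instead of the optimal
   [r] also covers [r = 0]. *)
have := step (- s / (r + 1)).
have -> : 2 * (- s / (r + 1)) * s + r * (- s / (r + 1)) ^+ 2 =
    - (s / (r + 1)) ^+ 2 * (r + 2) by field; lra.
have : 0 < (s / (r + 1)) ^+ 2 * (r + 2).
  rewrite mulr_gt0 //; last by lra.
  by rewrite exprn_even_gt0 //= mulf_neq0 // invr_neq0 //; lra.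
by lra.
Qed.

Lemma eigenvalue_nbsumP r :
  reflect (exists2 z, (exists x, z x != 0) & forall x, nbsum z x = r * z x)
          (eigenvalue (adjacency_mx G R) r).
Proof.
apply: (iffP eigenvalueP) => [[v vA v0]|[z [x zx] Az]].
  exists (fun x => v ord0 (enum_rank x)).
    have [i vi|v_eq0] := pickP (fun i => v ord0 i != 0).
      by exists (enum_val i); rewrite enum_valK.
    case/eqP: v0; apply/rowP => i.
    by have := v_eq0 i => /negbFE/eqP ->; rewrite mxE.
  move=> x; move/rowP/(_ (enum_rank x)): vA; rewrite !mxE => <-.
  rewrite (reindex (fun y => enum_rank y)) /=; last by apply: onW_bij; exact: enum_rank_bij.
  rewrite /nbsum big_mkcond; apply: eq_bigr => y _.
  by rewrite mxE !enum_rankK adj_sym; case: (G y x); rewrite ?mulr1 ?mulr0.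
exists (row_of_fun z); last first.
  by apply: contraNneq zx => /rowP/(_ (enum_rank x)); rewrite !mxE enum_rankK => ->.
apply/rowP => i; rewrite !mxE -Az.
rewrite (reindex (fun y => enum_rank y)) /=; last by apply: onW_bij; exact: enum_rank_bij.
rewrite /nbsum [RHS]big_mkcond; apply: eq_bigr => y _.
by rewrite !mxE !enum_rankK adj_sym; case: (G _ y); rewrite ?mulr1 ?mulr0.
Qed.

(** The form attains a maximum on the compact unit sphere, and homogeneity extends the bound to all
    vectors. *)
Lemma qform_max : (0 < #|T|)%N -> exists r z,
  [/\ exists x, z x != 0, forall x, nbsum z x = r * z x
    & forall w, qform w <= r * sqnorm w].
Proof.
case/card_gt0P => x0 _.
pose C := [set z : T -> R | sqnorm z = 1]%classic.
have cont_sq : continuous (sqnorm \o @fun_of_row R T).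
  apply: sum_continuous => x v.
  exact: (cvgM (@fun_of_row_continuous _ _ x v) (@fun_of_row_continuous _ _ x v)).
have cont_q : continuous ((fun z => - qform z) \o @fun_of_row R T).
  suff cq : continuous (fun v => qform (@fun_of_row R T v)) by move=> v; exact: (cvgN (cq v)).
  apply: sum_continuous => x v.
  have cN : continuous (fun v => nbsum (@fun_of_row R T v) x).
    have -> : (fun u => nbsum (@fun_of_row R T u) x) =
        fun u => \sum_y (if G x y then fun_of_row u y else 0).
      by apply/funext => u; rewrite /nbsum big_mkcond.
    apply: sum_continuous => y; case: (G x y) => u; first exact: fun_of_row_continuous.
    exact: (@cst_continuous _ R 0 u).
  exact: (cvgM (@fun_of_row_continuous _ _ x v) (cN v)).
have [||||z Cz zmin] := @compact_argmin R T C (fun z => - qform z) 1.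
- exists (fun x => (x == x0)%:R); rewrite /C /= /sqnorm (bigD1 x0) //= eqxx expr1n.
  by rewrite big1 ?addr0 // => x /negbTE ->; rewrite expr0n.
- move=> z x Cz; rewrite -(@ler_pXn2r R 2) ?nnegrE // expr1n real_normK ?num_real //.
  rewrite -Cz /sqnorm (bigD1 x) //= lerDl sumr_ge0 // => y _; exact: sqr_ge0.
- rewrite (_ : mkset _ = (sqnorm \o @fun_of_row R T) @^-1` [set y | y = 1])%classic //.
  by apply: preimage_closed; [move=> v _; exact: cont_sq | exact: closed_eq].
- exact: cont_q.
have qmax w : qform w <= qform z * sqnorm w.
  have [x wx|w0] := pickP (fun x => w x != 0); last first.
    have w_eq0 x : w x = 0 by apply/eqP/negbFE/w0.
    rewrite /sqnorm big1 => [|x _]; last by rewrite w_eq0 expr0n.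
    by rewrite /qform big1 ?mulr0 // => x _; rewrite w_eq0 mul0r.
  have N0 := sqnorm_gt0 wx; pose t := (Num.sqrt (sqnorm w))^-1.
  have t2 : t ^+ 2 = (sqnorm w)^-1 by rewrite exprVn sqr_sqrtr // ltW.
  have := zmin (fun x => t * w x); rewrite /C /= qformZ sqnormZ t2 mulVf ?gt_eqF //.
  by move/(_ erefl); rewrite lerN2 mulrC ler_pdivrMr.
exists (qform z), z; split=> //.
  have [x zx|z0] := pickP (fun x => z x != 0); first by exists x.
  move: Cz; rewrite /C /= /sqnorm big1 => [/eqP|x _]; first by rewrite eq_sym oner_eq0.
  by have /negbFE/eqP -> := z0 x; rewrite expr0n.
by apply: qform_max_eigen => //; rewrite Cz mulr1.
Qed.

(** The maximum of the Rayleigh quotient is an eigenvalue and bounds all eigenvalues, so it is the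
    supremum that defines [spectral_radius]. *)
Lemma spectral_radius_max : (0 < #|T|)%N -> exists2 z, exists x, z x != 0 &
  [/\ forall x, nbsum z x = spectral_radius G R * z x
     & forall w, qform w <= spectral_radius G R * sqnorm w].
Proof.
move=> /qform_max[r [z [z0 Az rmax]]].
suff <- : r = spectral_radius G R by exists z.
have r_ub : ubound [set x : R | eigenvalue (adjacency_mx G R) x]%classic r.
  move=> s /= /eigenvalue_nbsumP[w [x wx] Aw].
  have := rmax w; rewrite (qform_eigen Aw) ler_pM2r //.
  exact: sqnorm_gt0 wx.
have r_in : [set x : R | eigenvalue (adjacency_mx G R) x]%classic r.
  by apply/eigenvalue_nbsumP; exists z.
apply/eqP; rewrite eq_le; apply/andP; split.
  by apply: ub_le_sup => //; exists r.
by apply: ge_sup => //; exists r.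
Qed.

Lemma qform_le_spectral_radius z : qform z <= spectral_radius G R * sqnorm z.
Proof.
have [T0|/spectral_radius_max[_ _ []]//] := posnP #|T|.
by rewrite /qform /sqnorm ![\sum_(x : T) _]big1 ?mulr0 // => x _; have := card0_eq T0 x.
Qed.

(** Taking absolute values of the entries of a maximizing eigenvector keeps the norm and does not
    lower the form, so the result is maximizing and again an eigenvector. *)
Lemma perron_vector : (0 < #|T|)%N -> exists z,
  [/\ forall x, 0 <= z x, exists x, 0 < z x
    & forall x, nbsum z x = spectral_radius G R * z x].
Proof.
move=> /spectral_radius_max[z [x0 zx0] [Az rmax]].
exists (fun x => `|z x|); split=> [x||]; first exact: normr_ge0.
  by exists x0; rewrite normr_gt0.
apply: (qform_max_eigen rmax).
have -> : sqnorm (fun x => `|z x|) = sqnorm z.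
  by apply: eq_bigr => x _; rewrite real_normK ?num_real.
rewrite -(qform_eigen Az); apply: ler_sum => x _.
apply: le_trans (ler_norm _) _; rewrite normrM ler_wpM2l //.
exact: ler_norm_sum.
Qed.

(** The indicator function of [K] serves as test vector for the Rayleigh quotient. *)
Lemma clique_spectral_radius (K : {set T}) :
    {in K &, forall x y, x != y -> G x y} -> (0 < #|K|)%N ->
  #|K|%:R - 1 <= spectral_radius G R.
Proof.
move=> Kclique K0; pose z x : R := (x \in K)%:R.
have zN : sqnorm z = #|K|%:R.
  rewrite /sqnorm -sum1_card natr_sum [RHS]big_mkcond; apply: eq_bigr => x _.
  by rewrite /z; case: (x \in K); rewrite ?expr1n ?expr0n.
have := qform_le_spectral_radius z; rewrite zN.
have : (#|K|%:R - 1) * #|K|%:R <= qform z.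
  rewrite mulr_natr -sumr_const /qform [leRHS](bigID (mem K)) /= -[leLHS]addr0.
  apply: lerD; last by apply: sumr_ge0 => x /negbTE xK; rewrite /z xK mul0r.
  apply: ler_sum => x xK; rewrite {1}/z xK mul1r.
  have -> : #|K|%:R - 1 = \sum_(y in K | y != x) 1 :> R.
    by rewrite -sum1_card (bigD1 x) //= natrD natr_sum; ring.
  rewrite /nbsum big_mkcond [leRHS]big_mkcond; apply: ler_sum => y _; rewrite /z.
  case: ifP => [/andP[yK yx]|_]; first by rewrite Kclique 1?eq_sym // yK.
  by case: ifP.
by move=> le1 le2; rewrite -(ler_pM2r (_ : 0 < #|K|%:R)) ?ltr0n //; lra.
Qed.

(* The row sums of A^2 - (D - 1)A are at most the right-hand side. *)
Lemma hong_bound (D : nat) : (0 < #|T|)%N -> (forall x, D <= degree G x)%N ->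
  spectral_radius G R ^+ 2 - (D%:R - 1) * spectral_radius G R <=
    (\sum_x degree G x)%:R - (#|T|%:R - 1) * D%:R.
Proof.
move=> T0 degD; have [z [z0 [x0 zx0] Az]] := perron_vector T0.
set r := spectral_radius G R in Az *.
pose Z := \sum_x z x; pose e : R := \sum_x (degree G x)%:R.
have Z0 : 0 < Z.
  by rewrite /Z (bigD1 x0) //= ltr_pwDl // sumr_ge0.
have degE x : (degree G x)%:R = \sum_(y | G x y) 1 :> R.
  by rewrite sumr_const; congr (1 *+ _); apply: eq_card => y; rewrite !inE.
have sum_deg (F : T -> R) : \sum_x nbsum F x = \sum_x F x * (degree G x)%:R.
  have := nbsum_sym (fun=> 1) F; rewrite (eq_bigr (nbsum F)); last by move=> x _; rewrite mul1r.
  by move->; apply: eq_bigr => x _; rewrite degE.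
have dz : \sum_x z x * (degree G x)%:R = r * Z.
  by rewrite -sum_deg mulr_sumr; apply: eq_bigr => x _; rewrite Az.
(* The degree vector is A 1, so the left-hand side is the sum of the entries of A^2 z. *)
have ddz : \sum_x z x * nbsum (fun y => (degree G y)%:R) x = r ^+ 2 * Z.
  rewrite nbsum_sym; under eq_bigr do rewrite Az mulrCA.
  by rewrite -mulr_sumr; under eq_bigr do rewrite mulrC; rewrite dz; ring.
(* The row sum of A^2 at [x] is the sum of the degrees of its neighbours: the total degree, less the
   degree of [x], less at least [D] for each of the n - 1 - deg x other vertices. *)
have row x : nbsum (fun y => (degree G y)%:R) x <=
    e - #|T|%:R * D%:R + D%:R + (D%:R - 1) * (degree G x)%:R.
  have split_sum (F : T -> R) : \sum_y F y =
      \sum_(y | G x y) F y + (F x + \sum_(y | ~~ G x y && (y != x)) F y).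
    rewrite (bigID (G x)) /=; congr (_ + _).
    by rewrite (bigD1 x) ?adj_irrefl.
  have -> : e = \sum_y (degree G y)%:R by [].
  have -> : #|T|%:R * D%:R = \sum_(y : T) D%:R :> R by rewrite sumr_const mulr_natl.
  rewrite !split_sum /nbsum.
  have -> : \sum_(y | G x y) D%:R = D%:R * (degree G x)%:R :> R.
    by rewrite degE mulr_sumr; apply: eq_bigr => y _; rewrite mulr1.
  have : \sum_(y | ~~ G x y && (y != x)) D%:R <= \sum_(y | ~~ G x y && (y != x)) (degree G y)%:R :> R.
    by apply: ler_sum => y _; rewrite ler_nat.
  by lra.
rewrite natr_sum -/e -(ler_pM2r Z0).
have : \sum_x z x * nbsum (fun y => (degree G y)%:R) x <=
    \sum_x z x * (e - #|T|%:R * D%:R + D%:R + (D%:R - 1) * (degree G x)%:R).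
  by apply: ler_sum => x _; rewrite ler_wpM2l.
rewrite ddz; under eq_bigr do rewrite mulrDr mulrCA.
by rewrite big_split /= -mulr_suml -mulr_sumr dz -/Z; lra.
Qed.

End SpectralRadius.

(** * Monotonicity of the radius and the numerical use of Hong's bound *)

(** The Perron vector of [H], carried along [f], is a test vector for [G]; being nonnegative, it can
    only gain from additional edges. *)
Lemma spectral_radius_mono (R : realType) (T U : finType) (H : sgraph T)
    (G : sgraph U) (f : T -> U) :
    bijective f -> (forall x y, H x y -> G (f x) (f y)) -> (0 < #|T|)%N ->
  spectral_radius H R <= spectral_radius G R.
Proof.
move=> [g fK gK] HG T0; have [z [z0 [x0 zx0] Az]] := perron_vector R H T0.
have bf : bijective f by exists g.
pose w u := z (g u).
have wN : sqnorm w = sqnorm z.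
  rewrite /sqnorm (reindex f) /=; last exact: onW_bij.
  by apply: eq_bigr => x _; rewrite /w fK.
rewrite -(ler_pM2r (sqnorm_gt0 (lt0r_neq0 zx0))) -(qform_eigen Az) -wN.
apply: le_trans (qform_le_spectral_radius G w).
rewrite /qform [leRHS](reindex f) /=; last exact: onW_bij.
apply: ler_sum => x _; rewrite /w fK ler_wpM2l //.
rewrite /nbsum [leRHS](reindex f) /=; last exact: onW_bij.
rewrite big_mkcond [leRHS]big_mkcond; apply: ler_sum => y _; rewrite fK.
by case: ifP => [/HG ->//|_]; case: ifP.
Qed.

(** Ordered adjacent pairs outside [U] number at most (n - t)(n - t - 1), with t the size of [U];
    those meeting [U] are covered by counting the degrees in [U] once from each end. *)
Lemma sum_degree_le (T : finType) (G : sgraph T) (U : {set T}) :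
  (\sum_x degree G x <=
    (#|T| - #|U|) * (#|T| - #|U|).-1 + 2 * \sum_(x in U) degree G x)%N.
Proof.
have degE x : degree G x = (\sum_(y in U) G x y + \sum_(y in ~: U) G x y)%N.
  rewrite /degree -sum1_card big_mkcond (bigID (mem U)) /=; congr addn.
  by apply: eq_bigl => y; rewrite !inE.
rewrite (bigID (mem U)) /= mul2n -addnn addnCA leq_add2l.
have -> : (\sum_(x | x \notin U) degree G x =
    \sum_(x in ~: U) \sum_(y in U) G x y + \sum_(x in ~: U) \sum_(y in ~: U) G x y)%N.
  rewrite -big_split /=; apply: eq_big => [x|x _]; first by rewrite inE.
  exact: degE.
rewrite addnC leq_add //; last first.
  rewrite exchange_big /=; apply: leq_sum => x _; rewrite degE.
  by under eq_bigr do rewrite adj_sym; rewrite leq_addl.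
have -> : (#|T| - #|U|)%N = #|~: U| by rewrite [RHS]cardsCs finset.setCK.
rewrite -sum_nat_const; apply: leq_sum => x xU.
have -> : #|~: U|.-1 = (\sum_(y in ~: U | y != x) 1)%N.
  by rewrite (cardD1 x) xU /= -sum1_card; apply: eq_bigl => y; rewrite !inE andbC.
rewrite (bigD1 x) //= adj_irrefl add0n; apply: leq_sum => y _.
by case: (G x y).
Qed.

(* With [r] the spectral radius, [2 e] the degree sum and [n - t] the size of the
   clique, the lower bound [n - b - 2 <= r] is incompatible with Hong's bound. The
   two cases use [j < t] and [j <= n - t] for the last summand [2 (t - b) j]. *)
Lemma hong_bound_gap (R : realFieldType) (n t j b D k r e s : R) :
    2 <= b -> 1 <= D -> 0 <= k -> 0 <= j ->
    2 * (b + D + 2) * (b + k + 2) <= n ->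
    b + 2 <= t -> j + 1 <= t -> j + t <= n ->
    e <= (n - t) * (n - t - 1) + 2 * s -> s + b * j + 1 <= t * D + t * j ->
    n - b - 2 <= r -> r ^+ 2 - (D - 1) * r <= e - (n - 1) * D -> False.
Proof.
move=> b2 D1 k0 j0 hn tb jt jtn he hs hr hong.
have n8 : 8 * (b + D + 2) <= n.
  have : 0 <= (b + k - 2) * (b + D + 2) by rewrite mulr_ge0; lra.
  by lra.
have nbD : 2 * (b + D + 2) * (b + 2) <= n.
  have : 0 <= k * (b + D + 2) by rewrite mulr_ge0; lra.
  by lra.
(* The left-hand side of Hong's bound increases with [r] from [n - b - 2] on, so [r] may be replaced
   by that value. *)
have low : (n - b - 2) ^+ 2 + (n - b - 2) + (b + 1) * D + 2 <=
    (n - t) * (n - t - 1) + 2 * t * D + 2 * ((t - b) * j).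
  have : 0 <= (r - (n - b - 2)) * (r + (n - b - 2) - (D - 1)) by rewrite mulr_ge0; lra.
  by lra.
have bD : 0 <= b * D by rewrite mulr_ge0; lra.
have [tn|tn] := leP (2 * t) n.
  have : 0 <= (t - b) * (t - 1 - j) by rewrite mulr_ge0; lra.
  (* Once [j] is replaced by [t - 1], the gap in [low] is this product plus a term without [t],
     which the size of [n] makes positive. *)
  have : 0 <= (t - b - 2) * (2 * (n - b - 2) - 3 * (t - b - 2) - 2 * D - 2 * b - 7).
    by rewrite mulr_ge0; lra.
  have : 0 <= b ^+ 2 by exact: sqr_ge0.
  by lra.
have : 0 <= (t - b) * (n - t - j) by rewrite mulr_ge0; lra.
have : 0 <= (2 * t - n) * (n - 2 * b - 1 - 2 * D + (t - n / 2)).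
  by rewrite mulr_ge0; lra.
have : 0 <= n * (n / 4 - b - D - 7 / 2) by rewrite mulr_ge0; lra.
have : 0 <= (b + 2) ^+ 2 by exact: sqr_ge0.
by lra.
Qed.

(** * Perron vectors of a clique with a sparse set attached *)

Section TopSets.
Variables (R : realType) (T : finType) (f : T -> R).
Implicit Types A N W : {set T}.

Definition top_in W A := {in A & W :\: A, forall x y, f y <= f x}.

Lemma exists_top W r : (r <= #|W|)%N -> exists A, [/\ A \subset W, #|A| = r & top_in W A].
Proof.
elim: r => [_|r IHr rW].
  exists finset.set0; rewrite finset.sub0set cards0; split=> // x y; by rewrite inE.
have [A [AW Ar Atop]] := IHr (ltnW rW).
have /card_gt0P[x0 x0W] : (0 < #|W :\: A|)%N.
  by rewrite cardsD (finset.setIidPr AW) Ar subn_gt0.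
case: (arg_maxP f x0W) => x xW0 xmax; have xW : x \in (W :\: A)%SET := xW0.
have xA : x \notin A by move: xW; rewrite !inE => /andP[].
exists (x |: A)%SET; split.
- by rewrite finset.subUset finset.sub1set AW andbT; move: xW; rewrite inE => /andP[].
- by rewrite cardsU1 xA Ar.
move=> a y; rewrite !inE negb_or => /orP[/eqP->|aA] /andP[/andP[yx yA] yW].
  by apply: (xmax y); apply/setDP.
by apply: Atop => //; rewrite inE yA.
Qed.

(** The sets [A :\: N] and [N :\: A] have the same size, so each element of the second can be
    compared with the element [x] of the first where [f] is smallest. *)
Lemma sum_gap A N : #|N| = #|A| -> N != A -> exists2 x, x \in A :\: N &
  (0 < #|N :\: A|)%N /\ \sum_(y in N :\: A) (f x - f y) <= \sum_(y in A) f y - \sum_(y in N) f y.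
Proof.
move=> NA nNA; have cD : #|N :\: A| = #|A :\: N|.
  by rewrite !cardsD NA finset.setIC.
have D0 : (0 < #|A :\: N|)%N.
  rewrite lt0n; apply: contraNneq nNA => /eqP; rewrite cards_eq0 finset.setD_eq0 => AN.
  by rewrite eq_sym eqEcard AN NA /=.
case/card_gt0P: (D0) => x0 x0D; case: (arg_minP f x0D) => x xD0 xmin; have xD : x \in (A :\: N)%SET := xD0.
exists x => //; rewrite cD; split=> //.
rewrite [X in _ <= X - _](big_setID N) [X in _ <= _ - X](big_setID A) /= finset.setIC.
rewrite opprD addrACA subrr add0r sumrB lerD2r sumr_const cD -sumr_const.
by apply: ler_sum => y /xmin.
Qed.

Lemma top_sum_le A N : top_in [set: T]%SET A -> #|N| = #|A| ->
  \sum_(y in N) f y <= \sum_(y in A) f y.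
Proof.
move=> Atop NA; have [->//|/(sum_gap NA)[x xD [_]]] := eqVneq N A.
move=> gap; rewrite -subr_ge0; apply: le_trans gap; apply: sumr_ge0 => y yD.
move: xD yD; rewrite !inE => /andP[_ xA] /andP[yA _].
by rewrite subr_ge0; apply: Atop; rewrite // !inE yA.
Qed.

Lemma strict_top_sum_eq A N : {in A & ~: A, forall x y, f y < f x} -> #|N| = #|A| ->
  \sum_(y in N) f y = \sum_(y in A) f y -> N = A.
Proof.
move=> Atop NA eqS; apply/eqP; apply: contraT => /(sum_gap NA)[x xD [/card_gt0P[y0 y0D]]].
have gap y : y \in N :\: A -> 0 < f x - f y.
  move: xD; rewrite !inE => /andP[_ xA] /andP[yA _].
  by rewrite subr_gt0; apply: Atop; rewrite // !inE.
rewrite eqS subrr (bigD1 y0) //= leNgt => /negP[].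
by rewrite ltr_pwDl ?gap // sumr_ge0 // => y /andP[yD _]; exact/ltW/gap.
Qed.

(** The set [N] splits into as many elements as [A] has, whose sum is at most that over [A], and [e]
    others, each contributing at most [M]. *)
Lemma top_sum_excess A N e M : top_in [set: T]%SET A -> #|N| = (#|A| + e)%N ->
  (forall y, f y <= M) -> \sum_(y in N) f y <= \sum_(y in A) f y + e%:R * M.
Proof.
move=> Atop Ne fM; have [|N0 [N0N cN0 _]] := @exists_top N #|A|; first by rewrite Ne leq_addr.
rewrite (big_setID N0) /= (finset.setIidPr N0N) lerD ?top_sum_le //.
have -> : e = #|N :\: N0| by rewrite cardsD (finset.setIidPr N0N) cN0 Ne addKn.
by rewrite mulr_natl -sumr_const; apply: ler_sum.
Qed.

End TopSets.

Section CliqueWithSparseSet.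
Variables (R : realType) (T : finType) (G : sgraph T) (U : {set T}).
Hypothesis clique : {in ~: U &, forall x y, x != y -> G x y}.

Lemma nbsum_clique (z : T -> R) x : x \notin U ->
  nbsum G z x = (\sum_(y in ~: U) z y - z x) + \sum_(y in U | G x y) z y.
Proof.
move=> xU; rewrite /nbsum (bigID (mem U)) /= addrC; congr (_ + _); last first.
  by apply: eq_bigl => y; rewrite andbC.
have -> : \sum_(y in ~: U) z y - z x = \sum_(y in ~: U | y != x) z y.
  by rewrite (bigD1 x) ?inE //= addrAC subrr add0r.
apply: eq_bigl => y.
rewrite !inE; case yU: (y \in U); rewrite ?andbF //= andbT.
have [->|yx] := eqVneq y x; first by rewrite adj_irrefl.
by apply: clique; rewrite ?inE ?yU // eq_sym.
Qed.

(** On the clique the adjacency matrix is J - I, which gives the square of the sum minus the sum of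
    squares; the edges to [U] are regrouped by their end in [U]. *)
Lemma qform_clique_part (z : T -> R) :
  \sum_(x in ~: U) z x * nbsum G z x =
  (\sum_(x in ~: U) z x) ^+ 2 - \sum_(x in ~: U) z x ^+ 2 +
  \sum_(v in U) z v * \sum_(x in ~: U | G v x) z x.
Proof.
rewrite expr2 mulr_suml -sumrB.
have -> : \sum_(v in U) z v * \sum_(x in ~: U | G v x) z x =
    \sum_(x in ~: U) z x * \sum_(v in U | G x v) z v.
  under eq_bigr do rewrite mulr_sumr big_mkcondr /=.
  rewrite exchange_big /=; apply: eq_bigr => x _.
  rewrite mulr_sumr [RHS]big_mkcondr /=; apply: eq_bigr => v _.
  by rewrite adj_sym mulrC.
rewrite -big_split /=; apply: eq_bigr => x; rewrite inE => xU.
by rewrite nbsum_clique //; ring.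
Qed.

Variables (r : R) (y : T -> R) (d K : nat).
Hypotheses (y_ge0 : forall x, 0 <= y x) (y_neq0 : exists x, 0 < y x).
Hypothesis eigen : forall x, nbsum G y x = r * y x.
Hypotheses (Ud : {in U, forall v, degree G v <= d}%N).
Hypothesis UK : (\sum_(v in U) degree G v <= K)%N.
Hypotheses (rd : 2 * d%:R < r) (rK : 2 * K%:R < r * (r + 1)).

Lemma nbsum_le_max M x : (forall x, y x <= M) -> r * y x <= (degree G x)%:R * M.
Proof.
by move=> yM; rewrite -eigen /nbsum mulr_natl -sumr_const; apply: ler_sum.
Qed.

(** Degrees in [U] are below r/2, so entries there are below M/2 and the maximum [M] is attained on
    the clique. Subtracting the eigenvalue equations at two clique vertices leaves only the
    contribution of [U], whose entries sum to at most K M / r. *)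
Lemma perron_bounds : exists M, [/\ 0 < M, forall x, y x <= M,
    {in ~: U, forall x, r * (r + 1) * (M - y x) <= K%:R * M}
  & {in U & ~: U, forall v x, y v < y x}].
Proof.
have [x0 yx0] := y_neq0.
case: (arg_maxP y (erefl : xpredT x0)) => w _ wmax; pose M := y w.
have yM x : y x <= M by exact: wmax.
have M0 : 0 < M by apply: lt_le_trans yx0 (yM x0).
have d0 : 0 <= d%:R :> R by [].
have r0 : 0 < r by move: rd; lra.
have yU v : v \in U -> 2 * y v < M.
  move=> vU; have := nbsum_le_max v yM.
  have : (degree G v)%:R * M <= d%:R * M by rewrite ler_wpM2r ?(ltW M0) // ler_nat Ud.
  have : 2 * d%:R * M < r * M by rewrite ltr_pM2r.
  by move=> h1 h2 h3; rewrite -(ltr_pM2l r0); move: h1 h2 h3; lra.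
have wU : w \notin U by apply/negP => /yU; rewrite -/M; lra.
have sumU : r * \sum_(v in U) y v <= K%:R * M.
  apply: (@le_trans _ _ (\sum_(v in U) (degree G v)%:R * M)).
    by rewrite mulr_sumr; apply: ler_sum => v _; exact: nbsum_le_max.
  by rewrite -mulr_suml -natr_sum ler_wpM2r ?(ltW M0) // ler_nat.
have yW x : x \in ~: U -> r * (r + 1) * (M - y x) <= K%:R * M.
  rewrite inE => xU; apply: le_trans sumU; rewrite -mulrA ler_pM2l //.
  have := eigen x; have := eigen w; rewrite !nbsum_clique // -/M.
  have : 0 <= \sum_(v in U | G x v) y v by apply: sumr_ge0.
  have : \sum_(v in U | G w v) y v <= \sum_(v in U) y v.
    by rewrite big_mkcondr; apply: ler_sum => v _; case: ifP.
  by lra.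
exists M; split=> // v x vU /yW; have := yU v vU.
have : 2 * K%:R * M < r * (r + 1) * M by rewrite ltr_pM2r.
move=> ? ? ?; have : r * (r + 1) * (2 * (M - y x)) < r * (r + 1) * M by lra.
by rewrite ltr_pM2l ?mulr_gt0 //; lra.
Qed.

End CliqueWithSparseSet.

(** * The extremal graph *)

Section ExtremalGraph.
Variables (T : finType) (U A A' : {set T}) (v1 : T).

Definition extremal_nbhd (v : T) : {set T} := if v == v1 then A' else A.

Definition extremal_rel : rel T := fun x y =>
  if x \in U then (y \notin U) && (y \in extremal_nbhd x)
  else if y \in U then x \in extremal_nbhd y else x != y.

Lemma extremal_sym : symmetric extremal_rel.
Proof.
move=> x y; rewrite /extremal_rel; case: (x \in U); case: (y \in U) => //=.
by rewrite eq_sym.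
Qed.

Lemma extremal_irrefl : irreflexive extremal_rel.
Proof. by move=> x; rewrite /extremal_rel eqxx; case: (x \in U). Qed.

Definition extremal_graph : sgraph T := SGraph extremal_sym extremal_irrefl.

Lemma extremal_clique : {in ~: U &, forall x y, x != y -> extremal_graph x y}.
Proof.
by move=> x y; rewrite !inE /= /extremal_rel => /negbTE -> /negbTE ->.
Qed.

End ExtremalGraph.

(* The graphs [extremal_graph U A A' v1] with these data are exactly the copies of
   F_n^{a,b,k}, for D = a + k and E = a - 1. *)
Definition extremal_data (T : finType) (U : {set T}) (D E : nat) (A A' : {set T}) (v1 : T) :=
  [/\ A \subset A', A' \subset ~: U, #|A| = D, #|A'| = (D + E)%N & v1 \in U].

(** * Comparison with the extremal graphs *)

Section Extremality.
Variables (R : realType) (T : finType) (H : sgraph T) (U : {set T}) (D E b : nat).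
Hypothesis clique : {in ~: U &, forall x y, x != y -> H x y}.
Hypothesis cardU : #|U| = b.+1.
Hypothesis b_gt0 : (0 < b)%N.
Hypothesis D_gt0 : (0 < D)%N.
Hypothesis DE_le : (D + E <= #|~: U|)%N.
Hypothesis degD : {in U, forall v, D <= degree H v}%N.
Hypothesis sum_deg : (\sum_(v in U) degree H v <= b.+1 * D + E)%N.
Let r := spectral_radius H R.
Let K := (b.+1 * D + E)%N.
Hypothesis r_large : 2 * (D + E)%:R < r.
Hypothesis r_large2 : 2 * (D + E)%:R * K%:R < r * (r + 1).
Hypothesis r_max : forall A A' v1, extremal_data U D E A A' v1 ->
  spectral_radius (extremal_graph U A A' v1) R <= r.

(** The truncated subtraction is exact on [U], by [degD]. *)
Let excess v := (degree H v - D)%N.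

Lemma sum_excess : (\sum_(v in U) excess v <= E)%N.
Proof.
rewrite -(leq_add2l (b.+1 * D)) (leq_trans _ sum_deg) //.
rewrite -cardU -sum_nat_const -big_split /= leq_eqVlt; apply/orP; left; apply/eqP.
by apply: eq_bigr => v vU; rewrite subnKC // degD.
Qed.

Lemma degree_excess v : v \in U -> degree H v = (D + excess v)%N.
Proof. by move=> vU; rewrite subnKC // degD. Qed.

Lemma excess_le v : v \in U -> (excess v <= E)%N.
Proof. by move=> vU; rewrite (leq_trans _ sum_excess) // (bigD1 v) //= leq_addr. Qed.

Lemma degree_le v : v \in U -> (degree H v <= D + E)%N.
Proof.
move=> vU; rewrite degree_excess // leq_add2l; exact: excess_le.
Qed.

(** Each excess is then at most [E.-1], while the excesses sum to at most [E]. *)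
Lemma sum_sqr_excess : (forall v, v \in U -> excess v != E) ->
  (\sum_(v in U) excess v ^ 2 <= E.-1 * E)%N.
Proof.
move=> nE; apply: (@leq_trans (\sum_(v in U) E.-1 * excess v)%N).
  apply: leq_sum => v vU; rewrite leq_mul2r; apply/orP; right.
  by have := excess_le vU; have := nE v vU; lia.
by rewrite -big_distrr /= leq_mul2l sum_excess orbT.
Qed.

Lemma r_large_bounds : 0 < r /\ 2 * K%:R < r * (r + 1).
Proof.
have r0 : 0 < r by apply: le_lt_trans r_large; rewrite mulr_ge0.
split=> //; apply: le_lt_trans r_large2; rewrite ler_wpM2r // -[leLHS]mulr1.
by rewrite ler_wpM2l // ler1n addn_gt0 D_gt0.
Qed.

Section PerronVector.
Variable y : T -> R.
Hypotheses (y_ge0 : forall x, 0 <= y x) (y_neq0 : exists x, 0 < y x).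
Hypothesis eigen : forall x, nbsum H y x = r * y x.

Lemma H_perron_bounds : exists M, [/\ 0 < M, forall x, y x <= M,
    {in ~: U, forall x, r * (r + 1) * (M - y x) <= K%:R * M}
  & {in U & ~: U, forall v x, y v < y x}].
Proof.
have [_ rK] := r_large_bounds.
exact: (perron_bounds clique y_ge0 y_neq0 eigen degree_le sum_deg r_large rK).
Qed.

Lemma H_perron_gt0 x : x \in ~: U -> 0 < y x.
Proof.
have /card_gt0P[u uU] : (0 < #|U|)%N by rewrite cardU.
have [M [_ _ _ yUW]] := H_perron_bounds.
by move=> xU; apply: le_lt_trans (y_ge0 u) (yUW _ _ uU xU).
Qed.

Variables (A A' : {set T}) (v1 : T).
Hypothesis data : extremal_data U D E A A' v1.
Let F := extremal_graph U A A' v1.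
(** The entries on [U] are those that make the eigenvalue equation of [F] hold on [U] with the
    factor [r]. *)
Let z x := if x \in U then r^-1 * \sum_(w in extremal_nbhd A A' v1 x) y w else y x.

Lemma z_notin x : x \notin U -> z x = y x.
Proof. by rewrite /z => /negbTE ->. Qed.

Lemma z_in v : v \in U -> r * z v = \sum_(w in extremal_nbhd A A' v1 v) y w.
Proof.
by have [r0 _] := r_large_bounds; rewrite /z => ->; rewrite mulrA divff ?gt_eqF // mul1r.
Qed.

Lemma nbhd_notin v x : x \in extremal_nbhd A A' v1 v -> x \notin U.
Proof.
have [AA' A'U _ _ _] := data; rewrite /extremal_nbhd; case: ifP => _ xA.
  by have := fintype.subsetP A'U x xA; rewrite inE.
by have := fintype.subsetP A'U x (fintype.subsetP AA' x xA); rewrite inE.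
Qed.

Lemma F_nbhd v (f : T -> R) : v \in U ->
  \sum_(x in ~: U | F v x) f x = \sum_(w in extremal_nbhd A A' v1 v) f w.
Proof.
move=> vU; apply: eq_bigl => x; rewrite inE /F /= /extremal_rel vU.
by case xN: (x \in extremal_nbhd A A' v1 v); rewrite ?andbF // (nbhd_notin xN).
Qed.

Lemma F_nbsum v : v \in U -> nbsum F z v = r * z v.
Proof.
move=> vU; rewrite z_in // -F_nbhd // /nbsum big_mkcond [RHS]big_mkcond /=.
apply: eq_bigr => x _; rewrite inE /extremal_rel vU.
by case xU: (x \in U) => //=; rewrite z_notin ?xU.
Qed.

(* Both vectors agree on the clique, so the two Rayleigh forms differ only in the
   contribution of U. *)
Lemma qform_gain :
  r * (\sum_(v in U) z v ^+ 2 - \sum_(v in U) y v ^+ 2) <= qform F z - r * sqnorm z.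
Proof.
have [r0 _] := r_large_bounds.
have zy (f : R -> R) : \sum_(x in ~: U) f (z x) = \sum_(x in ~: U) f (y x).
  by apply: eq_bigr => x; rewrite inE => xU; rewrite z_notin.
have eqF : qform F z = r * \sum_(v in U) z v ^+ 2 +
    ((\sum_(x in ~: U) y x) ^+ 2 - \sum_(x in ~: U) y x ^+ 2 + r * \sum_(v in U) z v ^+ 2).
  rewrite /qform (bigID (mem U)) /= mulr_sumr; congr (_ + _).
    by apply: eq_bigr => v vU; rewrite F_nbsum //; ring.
  have -> : \sum_(x | x \notin U) z x * nbsum F z x = \sum_(x in ~: U) z x * nbsum F z x.
    by apply: eq_bigl => x; rewrite inE.
  rewrite (qform_clique_part (@extremal_clique T U A A' v1)) (zy id) (zy (fun t => t ^+ 2)).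
  congr (_ + _); apply: eq_bigr => v vU.
  rewrite -/F (eq_bigr y); last by move=> x /andP[]; rewrite inE => xU _; rewrite z_notin.
  by rewrite F_nbhd // -z_in //; ring.
have eqN : sqnorm z = \sum_(v in U) z v ^+ 2 + \sum_(x in ~: U) y x ^+ 2.
  rewrite -(zy (fun t => t ^+ 2)) /sqnorm (bigID (mem U)) /=; congr (_ + _).
  by apply: eq_bigl => x; rewrite inE.
have eqH : r * \sum_(x in ~: U) y x ^+ 2 =
    (\sum_(x in ~: U) y x) ^+ 2 - \sum_(x in ~: U) y x ^+ 2 +
    \sum_(v in U) y v * \sum_(x in ~: U | H v x) y x.
  rewrite -(qform_clique_part clique) mulr_sumr; apply: eq_bigr => x _.
  by rewrite eigen; ring.
(* Edges of [H] inside [U] are discarded here; this is an inequality because [y] is nonnegative. *)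
have : \sum_(v in U) y v * \sum_(x in ~: U | H v x) y x <= r * \sum_(v in U) y v ^+ 2.
  rewrite mulr_sumr; apply: ler_sum => v _.
  have -> : r * y v ^+ 2 = y v * (r * y v) by ring.
  rewrite ler_wpM2l // -eigen /nbsum big_mkcond [leRHS]big_mkcond; apply: ler_sum => x _.
  by rewrite inE; case: (x \in U) => //=; case: ifP.
by rewrite eqF eqN; lra.
Qed.

End PerronVector.

Lemma nbsum_nbhd (f : T -> R) v : nbsum H f v = \sum_(w in [set w | H v w]%SET) f w.
Proof. by apply: eq_bigl => w; rewrite inE. Qed.

Lemma card_nbhd v : #|[set w | H v w]%SET| = degree H v.
Proof. by apply: eq_card => w; rewrite !inE. Qed.

(* The squares of the excesses add up to at most E (E - 1) instead of E^2; this loss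
   outweighs the variation of the Perron entries on the clique. *)
Lemma spread_excess_loses (P P' M : R) : (0 < E)%N ->
    0 < M -> 0 <= P -> P <= D%:R * M ->
    (forall d, r * (r + 1) * d = K%:R * M -> P + E%:R * (M - d) <= P') ->
    (forall v, v \in U -> excess v != E) ->
  \sum_(v in U) (P + (excess v)%:R * M) ^+ 2 < b%:R * P ^+ 2 + P' ^+ 2.
Proof.
move=> E_gt0 M0 P0 PD P'ge nE; have [r0 rK] := r_large_bounds.
have rr0 : 0 < r * (r + 1) by rewrite mulr_gt0 // ltr_wpDr.
(* By the Perron bounds, [d] is the most by which an entry on the clique can fall below [M]. *)
pose d := K%:R * M / (r * (r + 1)).
have dE : r * (r + 1) * d = K%:R * M by rewrite /d mulrC divfK ?gt_eqF.
have d0 : 0 <= d by rewrite divr_ge0 ?(ltW rr0) // mulr_ge0 // ltW.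
have dM : 2 * (D + E)%:R * d < M.
  rewrite -(ltr_pM2l rr0) mulrCA dE.
  have : 2 * (D + E)%:R * K%:R * M < r * (r + 1) * M by rewrite ltr_pM2r.
  by lra.
have E1 : 1 <= E%:R :> R by rewrite ler1n.
have sumE : \sum_(v in U) (excess v)%:R <= E%:R :> R by rewrite -natr_sum ler_nat sum_excess.
have sumE2 : \sum_(v in U) (excess v)%:R ^+ 2 <= (E%:R - 1) * E%:R :> R.
  have := sum_sqr_excess nE; rewrite -(ler_nat R) natr_sum natrM -subn1 natrB //.
  by under eq_bigr do rewrite natrX.
have -> : \sum_(v in U) (P + (excess v)%:R * M) ^+ 2 = (b%:R + 1) * P ^+ 2 +
    2 * (P * M) * (\sum_(v in U) (excess v)%:R) +
    M ^+ 2 * \sum_(v in U) (excess v)%:R ^+ 2.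
  have -> : (b%:R + 1) * P ^+ 2 = \sum_(v in U) P ^+ 2.
    by rewrite sumr_const cardU -[RHS]mulr_natl -natr1.
  by rewrite !mulr_sumr -!big_split /=; apply: eq_bigr => v _; ring.
have PM0 : 0 <= P * M by rewrite mulr_ge0 // ltW.
have h1 := ler_wpM2l (sqr_ge0 M) sumE2.
have PM2 : 0 <= 2 * (P * M) by lra.
have h2 := ler_wpM2l PM2 sumE.
have DE1 : 1 <= (D + E)%:R :> R by rewrite ler1n addn_gt0 D_gt0.
have d_ltM : d <= M.
  have : 1 * d <= 2 * (D + E)%:R * d by rewrite ler_wpM2r //; lra.
  by lra.
have h3 : (P + E%:R * (M - d)) ^+ 2 <= P' ^+ 2.
  have := P'ge d dE => le_P'; rewrite ler_sqr ?nnegrE //.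
    by rewrite addr_ge0 // mulr_ge0 //; lra.
  by apply: le_trans le_P'; rewrite addr_ge0 // mulr_ge0 //; lra.
(* The saving [E M^2] in the sum of squares exceeds the loss, which is at most [2 E M (D + E) d];
   this is where [r_large2] enters, through [dM]. *)
have h4 : 0 < E%:R * (M * (M - 2 * (D + E)%:R * d)).
  by rewrite !mulr_gt0 //; lra.
have h5 : 0 <= E%:R * (d * (D%:R * M - P)) by rewrite mulr_ge0 // mulr_ge0 // subr_ge0.
have h6 : 0 <= E%:R ^+ 2 * d ^+ 2 by rewrite mulr_ge0 ?sqr_ge0.
move: h4; rewrite natrD; lra.
Qed.

(** If no vertex of [U] carries the whole surplus [E], redirecting strictly increases the form,
    against [r_max]. Otherwise equality holds throughout and [y] is also an eigenvector of the
    extremal graph. Its entries strictly separate [A] and [A'] from the remaining vertices, so no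
    other neighbourhoods reach the same sums. *)
Lemma extremality : exists A A' v1, extremal_data U D E A A' v1 /\
  forall x y, H x y = extremal_graph U A A' v1 x y.
Proof.
have [r0 rK] := r_large_bounds.
have /card_gt0P[u uU] : (0 < #|U|)%N by rewrite cardU.
have T0 : (0 < #|T|)%N by apply/card_gt0P; exists u.
have [y [y_ge0 y_neq0 eigen]] := perron_vector R H T0; rewrite -/r in eigen.
have [M [M0 yM yW yUW]] := H_perron_bounds y_ge0 y_neq0 eigen.
have [A' [A'U cA' A'top0]] := exists_top y DE_le.
have [|A [AA' cA Atop0]] := @exists_top R T y A' D; first by rewrite cA' leq_addr.
(* The set was chosen among clique vertices only, but all entries on [U] are smaller. *)
have A'top : top_in y [set: T]%SET A'.
  move=> x w xA'; rewrite !inE andbT => wA'; have xU := fintype.subsetP A'U x xA'.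
  have [wU|wU] := boolP (w \in U); first exact/ltW/yUW.
  by apply: A'top0; rewrite // !inE wA'.
have Atop : top_in y [set: T]%SET A.
  move=> x w xA; rewrite !inE andbT => wA; have xA' := fintype.subsetP AA' x xA.
  have [wA'|wA'] := boolP (w \in A'); first by apply: Atop0; rewrite // inE wA.
  by apply: A'top; rewrite // !inE wA'.
have yW_gt0 := H_perron_gt0 y_ge0 y_neq0 eigen.
pose P := \sum_(x in A) y x; pose P' := \sum_(x in A') y x.
have P_gt0 : 0 < P.
  have /card_gt0P[x xA] : (0 < #|A|)%N by rewrite cA.
  rewrite /P (bigD1 x) //= ltr_pwDl ?sumr_ge0 //.
  exact/yW_gt0/(fintype.subsetP A'U)/(fintype.subsetP AA').
pose z v1 x := if x \in U then r^-1 * \sum_(w in extremal_nbhd A A' v1 x) y w else y x.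
have gain v1 : v1 \in U -> \sum_(v in U) (z v1 v) ^+ 2 <= \sum_(v in U) y v ^+ 2 /\
    (\sum_(v in U) (z v1 v) ^+ 2 = \sum_(v in U) y v ^+ 2 ->
     forall x, nbsum (extremal_graph U A A' v1) (z v1) x =
               spectral_radius (extremal_graph U A A' v1) R * z v1 x).
  move=> v1U; have data : extremal_data U D E A A' v1 by split.
  have := qform_gain y_ge0 eigen data; rewrite -/(z v1).
  have le_r := ler_wpM2r (sqnorm_ge0 (z v1)) (r_max data).
  have le_q := qform_le_spectral_radius (extremal_graph U A A' v1) (z v1).
  move=> le_gain; split.
    by rewrite -subr_le0 -(pmulr_rle0 _ r0); lra.
  move=> eq_zy; apply: qform_max_eigen; first exact: qform_le_spectral_radius.
  by rewrite eq_zy subrr mulr0 in le_gain; lra.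
have z_in v1 v : v \in U -> r * z v1 v = \sum_(w in extremal_nbhd A A' v1 v) y w.
  by rewrite /z => ->; rewrite mulrA divff ?gt_eqF // mul1r.
have sqz v1 : v1 \in U -> r ^+ 2 * \sum_(v in U) (z v1 v) ^+ 2 = b%:R * P ^+ 2 + P' ^+ 2.
  move=> v1U; rewrite mulr_sumr (bigD1 v1) //= addrC -exprMn z_in // /extremal_nbhd eqxx.
  congr (_ + _); have -> : b%:R * P ^+ 2 = \sum_(v in U | v != v1) P ^+ 2.
    have <- : #|U :\ v1| = b by have := cardsD1 v1 U; rewrite v1U cardU => -[].
    rewrite mulr_natl -sumr_const; apply: eq_bigl => v.
    by rewrite !inE andbC.
  apply: eq_bigr => v /andP[vU /negbTE v1v].
  by rewrite -exprMn z_in // /extremal_nbhd v1v.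
have le_y v : v \in U -> r * y v <= P + (excess v)%:R * M.
  move=> vU; rewrite -eigen nbsum_nbhd; apply: top_sum_excess => //.
  by rewrite card_nbhd cA degree_excess.
have [/existsP[v1 /andP[v1U /eqP ex1]]|no_v1] :=
    boolP [exists v, (v \in U) && (excess v == E)]; last first.
  have nE v : v \in U -> excess v != E.
    by move=> vU; apply: contraNneq no_v1 => ex; apply/existsP; exists v; rewrite vU ex eqxx.
  have E_gt0 : (0 < E)%N.
    rewrite lt0n; apply: contraNneq (nE u uU) => E0.
    by rewrite E0 -leqn0 -E0 excess_le.
  (* Any vertex of [U] may receive the surplus; [u] is taken. *)
  have := (gain u uU).1; rewrite -(ler_pM2l (exprn_gt0 2 r0)) sqz // => le1.
  have : r ^+ 2 * \sum_(v in U) y v ^+ 2 <= \sum_(v in U) (P + (excess v)%:R * M) ^+ 2.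
    rewrite mulr_sumr; apply: ler_sum => v vU; rewrite -exprMn.
    rewrite ler_sqr ?nnegrE ?le_y // ?mulr_ge0 ?(ltW r0) //.
    by rewrite addr_ge0 ?(ltW P_gt0) // mulr_ge0 // ltW.
  move=> /(le_trans le1); rewrite leNgt spread_excess_loses ?(ltW P_gt0) //.
    by rewrite -cA mulr_natl -sumr_const; apply: ler_sum.
  move=> d dE; rewrite /P' (big_setID A) /= (finset.setIidPr AA') lerD2l.
  have -> : E = #|A' :\: A| by rewrite cardsD (finset.setIidPr AA') cA cA' addKn.
  rewrite mulr_natl -sumr_const; apply: ler_sum => x; rewrite inE => /andP[_ xA'].
  have := yW x (fintype.subsetP A'U x xA'); rewrite -dE.
  by rewrite ler_pM2l ?mulr_gt0 ?ltr_wpDr //; lra.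
have ex0 v : v \in U -> v != v1 -> excess v = 0%N.
  move=> vU vv1; have := sum_excess; rewrite (bigD1 v1) //= ex1 (bigD1 v) ?vU //=.
  by rewrite -[leqRHS]addn0 leq_add2l leqn0 addn_eq0 => /andP[/eqP].
have card_ext v : v \in U -> #|[set w | H v w]%SET| = #|extremal_nbhd A A' v1 v|.
  move=> vU; rewrite card_nbhd degree_excess // /extremal_nbhd.
  by have [->|vv1] := eqVneq v v1; rewrite ?ex1 ?cA' // ex0 // addn0 cA.
have yz v : v \in U -> y v <= z v1 v.
  move=> vU; rewrite -(ler_pM2l r0) z_in // -eigen nbsum_nbhd.
  by apply: top_sum_le (card_ext v vU); rewrite /extremal_nbhd; case: ifP.
have sqz_ge v : v \in U -> y v ^+ 2 <= z v1 v ^+ 2.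
  by move=> vU; rewrite ler_sqr ?nnegrE ?yz // (le_trans (y_ge0 v) (yz v vU)).
have [le_zy eigenF] := gain v1 v1U.
(* Entrywise [y] is at most [z v1] on [U], while [gain] bounds the sum of squares the other way. *)
have eq_zy : \sum_(v in U) z v1 v ^+ 2 = \sum_(v in U) y v ^+ 2.
  by apply/eqP; rewrite eq_le le_zy ler_sum.
have zv v : v \in U -> z v1 v = y v.
  move=> vU; have z0 := le_trans (y_ge0 v) (yz v vU).
  apply/eqP; rewrite eq_le yz // andbT -ler_sqr ?nnegrE //; move: eq_zy; rewrite (bigD1 v) //= [RHS](bigD1 v) //=.
  have : \sum_(w in U | w != v) y w ^+ 2 <= \sum_(w in U | w != v) z v1 w ^+ 2.
    by apply: ler_sum => w /andP[wU _]; exact: sqz_ge.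
  by lra.
have zW x : x \in ~: U -> z v1 x = y x by rewrite inE /z => /negbTE ->.
have z_gt0 v : v \in U -> 0 < z v1 v.
  move=> vU; rewrite -(pmulr_rgt0 _ r0) z_in //.
  have /card_gt0P[x xN] : (0 < #|extremal_nbhd A A' v1 v|)%N.
    by rewrite /extremal_nbhd; case: ifP => _; rewrite ?cA' ?cA // addn_gt0 D_gt0.
  rewrite (bigD1 x) //= ltr_pwDl ?sumr_ge0 //; apply: yW_gt0.
  move: xN; rewrite /extremal_nbhd; case: ifP => _ xN; apply: (fintype.subsetP A'U) => //.
  exact: (fintype.subsetP AA').
have {}eigenF := eigenF eq_zy.
set F := extremal_graph U A A' v1 in eigenF; set rF := spectral_radius F R in eigenF.
(* In F, the Perron entries on the clique increase with the neighbourhood in U. *)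
have y_lt x w v : x \in ~: U -> w \in ~: U -> v \in U ->
    (forall v', v' \in U -> w \in extremal_nbhd A A' v1 v' -> x \in extremal_nbhd A A' v1 v') ->
    x \in extremal_nbhd A A' v1 v -> w \notin extremal_nbhd A A' v1 v -> y w < y x.
  move=> xU wU vU sub xv wv.
  have FU t : t \in ~: U -> \sum_(v' in U | F t v') z v1 v' =
      \sum_(v' in U | t \in extremal_nbhd A A' v1 v') z v1 v'.
    rewrite inE => tU; apply: eq_bigl => v'; rewrite /F /= /extremal_rel (negbTE tU).
    by case: (v' \in U).
  have lt_sum : \sum_(v' in U | F w v') z v1 v' < \sum_(v' in U | F x v') z v1 v'.
    rewrite !FU // big_mkcondr [ltRHS]big_mkcondr /= (bigD1 v) //= [ltRHS](bigD1 v) //=.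
    rewrite (negbTE wv) xv; apply: ltr_leD; first exact: z_gt0.
    apply: ler_sum => v' /andP[v'U _]; case: ifP => [/(sub _ v'U) ->//|_].
    by case: ifP => // _; exact/ltW/z_gt0.
  have := eigenF x; have := eigenF w.
  rewrite !(nbsum_clique (@extremal_clique T U A A' v1)) -?finset.in_setC // -/F !zW //.
  have rF1 : 0 < rF + 1.
    have : #|~: U|%:R - 1 <= rF.
      apply: clique_spectral_radius; first exact: extremal_clique.
      by apply/card_gt0P; exists x.
    have : 1 <= #|~: U|%:R :> R by rewrite ler1n; apply/card_gt0P; exists x.
    by lra.
  by move=> ? ?; rewrite -(ltr_pM2l rF1); lra.
have A_lt x w : x \in A -> w \in ~: A -> y w < y x.
  rewrite inE => xA wA; have xU := fintype.subsetP A'U x (fintype.subsetP AA' x xA).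
  have [wU|wU] := boolP (w \in U); first exact: yUW.
  (* Since [b] is positive, [U] has a second vertex, whose neighbourhood is [A] itself. *)
  have [v vU vv1] : exists2 v, v \in U & v != v1.
    have cU1 : #|U :\ v1| = b by have := cardsD1 v1 U; rewrite v1U cardU => -[].
    have /card_gt0P[v] : (0 < #|U :\ v1|)%N by rewrite cU1.
    by rewrite !inE => /andP[]; exists v.
  apply: (y_lt x w v) => //; rewrite ?inE // /extremal_nbhd ?(negbTE vv1) //.
  by move=> v' _; case: ifP => // _ _; exact: (fintype.subsetP AA').
have A'_lt x w : x \in A' -> w \in ~: A' -> y w < y x.
  rewrite inE => xA wA; have xU := fintype.subsetP A'U x xA.
  have [wU|wU] := boolP (w \in U); first exact: yUW.
  apply: (y_lt x w v1) => //; rewrite ?inE // /extremal_nbhd ?eqxx //.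
  move=> v' _; case: ifP => // _ wA0.
  by rewrite (fintype.subsetP AA' w wA0) in wA.
have nbhdE v : v \in U -> [set w | H v w]%SET = extremal_nbhd A A' v1 v.
  move=> vU; apply: (@strict_top_sum_eq R T y) (card_ext v vU) _.
    by rewrite /extremal_nbhd; case: ifP.
  by rewrite -nbsum_nbhd eigen -z_in // zv.
have HU v w : v \in U -> H v w = extremal_rel U A A' v1 v w.
  move=> vU; have -> : H v w = (w \in [set w | H v w]%SET) by rewrite inE.
  rewrite nbhdE // /extremal_rel vU; case wN: (w \in extremal_nbhd A A' v1 v); rewrite ?andbF //.
  rewrite andbT; apply/esym; move: wN; rewrite /extremal_nbhd; case: ifP => _ wN.
    by have := fintype.subsetP A'U w wN; rewrite inE.
  by have := fintype.subsetP A'U w (fintype.subsetP AA' w wN); rewrite inE.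
exists A, A', v1; split; first by split.
move=> x w; have [xU|xU] := boolP (x \in U); first exact: HU.
have [wU|wU] := boolP (w \in U); first by rewrite adj_sym HU // extremal_sym.
rewrite /= /extremal_rel (negbTE xU) (negbTE wU).
have [->|xw] := eqVneq x w; first by rewrite adj_irrefl.
by apply: clique; rewrite ?inE.
Qed.

End Extremality.

(** * Identification with [F_graph] *)

Lemma F_graph_extremal (T : finType) (U A A' : {set T}) (v1 : T) (a b k : nat) :
    (0 < a)%N -> #|U| = b.+1 -> extremal_data U (a + k) a.-1 A A' v1 ->
  exists2 g : 'I_(a + k) + ('I_(#|T| - (a + b + k + 1)) + 'I_b.+1) -> T,
    bijective g
    & forall x y, F_graph #|T| a b k x y = extremal_graph U A A' v1 (g x) (g y).
Proof.
move=> a0 cU [AA' A'U cA cA' v1U].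
have cC : #|~: U| = (#|T| - b.+1)%N by have := cardsC U; rewrite cU; lia.
have cA'U : (#|A'| <= #|~: U|)%N by exact: subset_leq_card.
have ET : #|T| = (b.+1 + #|~: U|)%N by rewrite -(cardsC U) cU.
(* The set [A] becomes the joined clique. Listing [A' :\: A] first in the middle clique and [v1]
   first in [U] matches the indices at which [F_graph] adds its edges. *)
pose s1 := enum A; pose sX := enum (A' :\: A).
pose s2 := sX ++ enum (~: U :\: A'); pose s3 := v1 :: enum (U :\ v1).
have z1 : size s1 = (a + k)%N by rewrite -cardE cA.
have zX : size sX = a.-1 by rewrite -cardE cardsD (finset.setIidPr AA') cA cA'; lia.
have z2 : size s2 = (#|T| - (a + b + k + 1))%N.
  rewrite size_cat zX -cardE cardsD (finset.setIidPr A'U) cC cA'.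
  by rewrite cC cA' in cA'U; lia.
have z3 : size s3 = b.+1.
  rewrite /= -cardE; have := cardsD1 v1 U; rewrite v1U cU => ->.
  by rewrite addnC addn1.
have u1 : uniq s1 by exact: enum_uniq.
have u2 : uniq s2.
  rewrite cat_uniq !enum_uniq andbT /=; apply/hasPn => x.
  by rewrite !mem_enum !inE => /andP[/negbTE->]; rewrite andbF.
have u3 : uniq s3 by rewrite /= enum_uniq mem_enum !inE eqxx.
pose g (x : 'I_(a + k) + ('I_(#|T| - (a + b + k + 1)) + 'I_b.+1)) := match x with
  | inl i => nth v1 s1 i
  | inr (inl i) => nth v1 s2 i
  | inr (inr i) => nth v1 s3 i end.
have A_U x : x \in A -> x \notin U.
  by move=> /(fintype.subsetP AA')/(fintype.subsetP A'U); rewrite inE.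
have A'_U x : x \in A' -> x \notin U by move=> /(fintype.subsetP A'U); rewrite inE.
have g1 i : g (inl i) \in A by rewrite -mem_enum mem_nth // z1.
have g2 (i : 'I_(#|T| - (a + b + k + 1))) : (g (inr (inl i)) \notin U) * (g (inr (inl i)) \notin A).
  have : g (inr (inl i)) \in s2 by rewrite mem_nth // z2.
  rewrite mem_cat !mem_enum !inE => /orP[/andP[xA xA']|/andP[xA' xU]]; first by rewrite A'_U.
  by rewrite xU; split=> //; apply: contra xA'; exact: (fintype.subsetP AA').
have g2A' (i : 'I_(#|T| - (a + b + k + 1))) : (g (inr (inl i)) \in A') = (i < a.-1)%N.
  rewrite /= nth_cat zX; case: ltnP => ia.
    have : nth v1 sX i \in sX by rewrite mem_nth ?zX.
    by rewrite mem_enum inE => /andP[].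
  have : nth v1 (enum (~: U :\: A')) (i - a.-1) \in enum (~: U :\: A').
    rewrite mem_nth // -(ltn_add2l a.-1) subnKC //.
    by have := ltn_ord i; rewrite -{2}z2 size_cat zX.
  by rewrite mem_enum inE => /andP[/negbTE].
have g3 (i : 'I_b.+1) : g (inr (inr i)) \in U.
  have : g (inr (inr i)) \in s3 by rewrite mem_nth // z3.
  by rewrite inE mem_enum => /predU1P[->//|]; rewrite inE => /andP[].
have g3v1 (i : 'I_b.+1) : (g (inr (inr i)) == v1) = (i == ord0).
  by apply: (@nth_uniq _ v1 s3 i 0); rewrite ?z3.
have e1 i j : (g (inl i) == g (inl j)) = (i == j) by rewrite /= nth_uniq ?z1.
have e2 (i j : 'I_(#|T| - (a + b + k + 1))) : (g (inr (inl i)) == g (inr (inl j))) = (i == j).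
  by rewrite /= (nth_uniq v1 _ _ u2) ?z2.
have e3 (i j : 'I_b.+1) : (g (inr (inr i)) == g (inr (inr j))) = (i == j).
  by rewrite /= (nth_uniq v1 _ _ u3) ?z3.
have n12 i j : g (inl i) != g (inr (inl j)).
  by apply: contraTneq (g1 i) => ->; rewrite g2.
have n13 i j : g (inl i) != g (inr (inr j)).
  by apply: contraTneq (g3 j) => <-; rewrite A_U.
have n23 i j : g (inr (inl i)) != g (inr (inr j)).
  by apply: contraTneq (g3 j) => <-; rewrite g2.
exists g.
  apply: inj_card_bij; last first.
    by rewrite !card_sum !card_ord; rewrite cA' cC in cA'U; lia.
  move=> [i|[i|i]] [j|[j|j]] /eqP; rewrite ?e1 ?e2 ?e3 => /eqP gij; try by rewrite gij.
  - by have := n12 i j; rewrite gij eqxx.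
  - by have := n13 i j; rewrite gij eqxx.
  - by have := n12 j i; rewrite gij eqxx.
  - by have := n23 i j; rewrite gij eqxx.
  - by have := n13 j i; rewrite gij eqxx.
  - by have := n23 j i; rewrite gij eqxx.
have A_nbhd v x : x \in A -> x \in extremal_nbhd A A' v1 v.
  by rewrite /extremal_nbhd; case: ifP => // _; exact: (fintype.subsetP AA').
have FE x y : extremal_graph U A A' v1 x y = extremal_rel U A A' v1 x y by [].
have F12 i j : extremal_graph U A A' v1 (g (inl i)) (g (inr (inl j))).
  by rewrite FE /extremal_rel (negbTE (A_U _ (g1 i))) (negbTE (g2 j).1) n12.
have F13 i j : extremal_graph U A A' v1 (g (inl i)) (g (inr (inr j))).
  by rewrite FE /extremal_rel (negbTE (A_U _ (g1 i))) g3 A_nbhd.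
have F23 i j : extremal_graph U A A' v1 (g (inr (inl i))) (g (inr (inr j))) =
    ((j == ord0) && (i < a.-1)%N).
  rewrite FE /extremal_rel (negbTE (g2 i).1) g3 /extremal_nbhd g3v1.
  by case: (j == ord0); rewrite ?g2A' ?(negbTE (g2 i).2).
move=> [i|[i|i]] [j|[j|j]].
- by rewrite FE /extremal_rel !(negbTE (A_U _ (g1 _))) e1 /= /add_rel /= andbF orbF.
- by rewrite F12.
- by rewrite F13.
- by rewrite adj_sym [RHS]adj_sym F12.
- by rewrite FE /extremal_rel !(negbTE (g2 _).1) e2 /= /add_rel /= andbF orbF.
- by rewrite F23 /= /add_rel /= ?orbF.
- by rewrite adj_sym [RHS]adj_sym F13.
- by rewrite adj_sym [RHS]adj_sym F23 /= /add_rel /= ?orbF.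
- by rewrite FE /extremal_rel !g3 /= /add_rel /= andbF.
Qed.

(** * The obstruction in the original graph, clique completion and numerical bounds *)

Lemma min_degree_le (T : finType) (G : sgraph T) v : (min_degree G <= degree G v)%N.
Proof.
rewrite /min_degree; have := mem_index_enum v.
elim: (index_enum T) => // w s IHs; rewrite inE big_cons => /orP[/eqP->|/IHs le_v].
  exact: geq_minl.
by apply: leq_trans le_v; exact: geq_minr.
Qed.

(** Passing from G - X back to [G] adds to the degree of a vertex of [U] at most the sizes of [X]
    and of the set [S] of the obstruction; [j] is the size of [S]. *)
Lemma deletion_obstruction (R : realType) (T : finType) (G : sgraph T) (X : {set T})
    (a b : nat) :
    (a <= b)%N -> ~ has_fractional_factor (delete_vertices G X) R a b ->
  exists (U : {set T}) (j : nat), [/\ (#|X| + j + #|U| <= #|T|)%N,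
    (b * j < a * #|U|)%N &
    (\sum_(v in U) degree G v + b * j < #|U| * (a + #|X| + j))%N].
Proof.
move=> ab /(fractional_factor_obstruction ab)[S [U [dSU lt_aU]]].
pose q u := #|[set w | delete_vertices G X u w & w \notin S]%SET|.
have inj_val : injective (val : {x | x \notin X} -> T) by exact: val_inj.
exists (val @: U)%SET, #|S|; rewrite card_imset //; split.
- rewrite -(cardsC X) -addnA leq_add2l -cardsUI (eqP (_ : S :&: U == finset.set0)%SET).
    rewrite cards0 addn0; apply: leq_trans (max_card _) _.
    by rewrite card_sig; apply/eq_leq/eq_card => x; rewrite !inE.
  by rewrite setI_eq0.
- by apply: leq_ltn_trans lt_aU; rewrite leq_addr.
rewrite big_imset; last by move=> x y _ _; exact: inj_val.
have deg_le u : u \in U -> (degree G (val u) <= q u + (#|X| + #|S|))%N.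
  move=> _; rewrite /degree.
  have sub : [pred w | G (val u) w] \subset
      (val @: [set w | delete_vertices G X u w & w \notin S]) :|: (X :|: val @: S).
    apply/fintype.subsetP => w; rewrite !inE => uw.
    have [//|wX] := boolP (w \in X); rewrite ?orbT //.
    pose w' : {x | x \notin X} := exist _ w wX.
    have [wS|wS] := boolP (w' \in S); apply/orP; [right|left].
      by apply/imsetP; exists w'.
    by apply/imsetP; exists w' => //; rewrite inE wS andbT.
  apply: (leq_trans (subset_leq_card sub)); apply: (leq_trans (leq_card_setU _ _).1).
  rewrite card_imset // leq_add2l (leq_trans (leq_card_setU _ _).1) //.
  by rewrite card_imset.
apply: (@leq_ltn_trans (\sum_(u in U) (q u + (#|X| + #|S|)) + b * #|S|)%N).
  by rewrite leq_add2r; exact: leq_sum.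
rewrite big_split /= sum_nat_const.
have arith x s u d : (b * s + d < a * u -> d + u * (x + s) + b * s < u * (a + x + s))%N.
  by nia.
exact: arith.
Qed.

(** The two cliques of [F_graph] are joined into one clique with n - b - 1 vertices. *)
Lemma F_graph_radius_ge (R : realType) (n a b k : nat) :
    (0 < a)%N -> (a + b + k + 1 <= n)%N ->
  n%:R - b%:R - 2 <= spectral_radius (F_graph n a b k) R.
Proof.
move=> a0 nabk.
pose f (x : 'I_(a + k) + 'I_(n - (a + b + k + 1))) :
    'I_(a + k) + ('I_(n - (a + b + k + 1)) + 'I_b.+1) :=
  match x with inl i => inl i | inr i => inr (inl i) end.
have f_inj : injective f by move=> [i|i] [j|j] //= [->].
pose K := [set f x | x in [set: 'I_(a + k) + 'I_(n - (a + b + k + 1))]]%SET.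
have cK : #|K| = (n - b.+1)%N.
  by rewrite card_imset // cardsT card_sum !card_ord; lia.
have -> : n%:R - b%:R - 2 = #|K|%:R - 1 :> R.
  rewrite cK natrB; last by lia.
  by rewrite -natr1; ring.
apply: clique_spectral_radius; last by rewrite cK; lia.
move=> _ _ /imsetP[x _ ->] /imsetP[y _ ->]; rewrite (inj_eq f_inj) => xy.
by case: x y xy => [i|i] [j|j] //= xy; rewrite /add_rel /= xy.
Qed.

Section CliqueCompletion.
Variables (T : finType) (G : sgraph T) (U : {set T}).

(** Adding edges only outside [U] preserves the degrees on [U] and cannot lower the radius. *)
Definition completion_rel : rel T := fun x y =>
  G x y || [&& x \notin U, y \notin U & x != y].

Lemma completion_sym : symmetric completion_rel.
Proof. by move=> x y; rewrite /completion_rel adj_sym andbCA eq_sym. Qed.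

Lemma completion_irrefl : irreflexive completion_rel.
Proof. by move=> x; rewrite /completion_rel adj_irrefl eqxx !andbF. Qed.

Definition completion : sgraph T := SGraph completion_sym completion_irrefl.

Lemma completion_clique : {in ~: U &, forall x y, x != y -> completion x y}.
Proof.
by move=> x y; rewrite !inE /= /completion_rel => -> -> ->; rewrite orbT.
Qed.

Lemma completion_degree v : v \in U -> degree completion v = degree G v.
Proof.
move=> vU; apply: eq_card => w; rewrite !inE /= /completion_rel vU /=.
by rewrite orbF.
Qed.

Lemma sub_completion x y : G x y -> completion x y.
Proof. by rewrite /= /completion_rel => ->. Qed.

End CliqueCompletion.

(** As n - b - 2 bounds the radius from below, the first bound gives [r_large] and its product with
    the second gives [r_large2]. The third keeps the truncated subtraction in [F_graph] exact. *)
Lemma large_order_bounds (n a b k : nat) : (0 < a)%N -> (a < b)%N ->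
    (2 * (b + a + k + 2) * (b + k + 2) <= n)%N ->
  [/\ (2 * (a + k + a.-1) < n - b - 2)%N, (b.+1 * (a + k) + a.-1 <= n - b - 2)%N
    & (a + b + k + 1 <= n)%N].
Proof.
move=> a0 ab hn.
have h1 : (8 * (b + a + k + 2) <= n)%N.
  apply: leq_trans hn; rewrite mulnAC -[8%N]/(2 * 4)%N leq_mul2r; apply/orP; right.
  by rewrite leq_mul2l; lia.
have h2 : (2 * (b + a + k + 2) * (b + 2) <= n)%N.
  by apply: leq_trans hn; rewrite leq_mul2l; apply/orP; right; lia.
by split; nia.
Qed.

(** * From a failed deletion to the extremal graph *)

Theorem theorem1p7 (R : realType) (a b k : nat) (T : finType) (G : sgraph T)
    (ha : (1 <= a)%N) (hab : (a < b)%N)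
    (hconn : connected G)
    (hn : (2 * (b + a + k + 2) * (b + k + 2) <= #|T|)%N)
    (hdeg : (a + k <= min_degree G)%N)
    (hlam : (spectral_radius (F_graph #|T| a b k) R <= spectral_radius G R)%R) :
  fractional_critical R G a b k \/ isomorphic G (F_graph #|T| a b k).
Proof.
have [|not_crit] := pselect (fractional_critical R G a b k); [by left | right].
have [X cX no_factor] : exists2 X : {set T}, #|X| = k &
    ~ has_fractional_factor (delete_vertices G X) R a b.
  apply: contrapT => no_X; apply: not_crit => X cX.
  by apply: contrapT => no_factor; apply: no_X; exists X.
have [U [j [jUT bj_lt sum_lt]]] := deletion_obstruction (ltnW hab) no_factor.
rewrite cX in jUT sum_lt.
have degD v : (a + k <= degree G v)%N by rewrite (leq_trans hdeg) ?min_degree_le.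
have [large1 large2 large3] := large_order_bounds ha hab hn.
have T0 : (0 < #|T|)%N by lia.
have r_ge : #|T|%:R - b%:R - 2 <= spectral_radius G R.
  by apply: le_trans hlam; exact: F_graph_radius_ge.
have sum_ge : (#|U| * (a + k) <= \sum_(v in U) degree G v)%N.
  by rewrite -sum_nat_const; apply: leq_sum.
(* The degrees in [U] sum to at least [#|U| * (a + k)], so [sum_lt] leaves [b * j < #|U| * j]. *)
have bU : (b < #|U|)%N.
  have : (b * j < #|U| * j)%N.
    rewrite -(ltn_add2l (#|U| * (a + k))) -mulnDr.
    by apply: leq_ltn_trans sum_lt; rewrite leq_add2r.
  by rewrite ltn_mul2r => /andP[].
have jU : (j < #|U|)%N.
  have : (b * j < b * #|U|)%N by apply: leq_trans bj_lt _; rewrite leq_mul2r (ltnW hab) orbT.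
  by rewrite ltn_mul2l => /andP[].
have [Ub|Ub] := ltnP b.+1 #|U|.
  exfalso; apply: (@hong_bound_gap R #|T|%:R #|U|%:R j%:R b%:R (a + k)%:R k%:R
    (spectral_radius G R) (\sum_x degree G x)%:R (\sum_(v in U) degree G v)%:R) => //.
  - by rewrite ler_nat; lia.
  - by rewrite ler1n; lia.
  - by rewrite -!natrD -!natrM ler_nat; lia.
  - by rewrite -natrD ler_nat; lia.
  - by rewrite natr1 ler_nat.
  - by rewrite -natrD ler_nat; lia.
  - have UT : (#|U| <= #|T|)%N by lia.
    have := sum_degree_le G U; rewrite -(ler_nat R) natrD !natrM.
    (* When [U] is everything, the truncated predecessor in [sum_degree_le] is not a true
       difference, but it is multiplied by 0. *)
    case: (posnP (#|T| - #|U|)) => [TU|TU]; last by rewrite -subn1 !natrB.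
    have -> : #|T|%:R = #|U|%:R :> R by congr (_%:R); lia.
    by rewrite TU subrr !mul0r.
  - move: sum_lt; rewrite -addn1 -(ler_nat R) => sum_le.
    by move: sum_le; rewrite !(natrD, natrM); lra.
  - exact: hong_bound.
have cU : #|U| = b.+1 by lia.
(* With [b + 1] vertices in [U], the degree sum exceeds [(b + 1)(a + k)] by less than [j], hence by
   at most [a - 1]: the number of extra edges of [F_graph]. *)
have ja : (j <= a)%N by clear - bj_lt cU hab; rewrite cU in bj_lt; nia.
pose H := completion G U.
have GH : spectral_radius G R <= spectral_radius H R.
  by apply: (@spectral_radius_mono R _ _ _ _ id) => //; [exists id | exact: sub_completion].
have degH v : v \in U -> degree H v = degree G v by exact: completion_degree.
have cC : #|~: U| = (#|T| - b.+1)%N by have := cardsC U; rewrite cU; lia.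
have b0 : (0 < b)%N by lia.
have D0 : (0 < a + k)%N by lia.
have DE : (a + k + a.-1 <= #|~: U|)%N by rewrite cC; lia.
have degHD : {in U, forall v, a + k <= degree H v}%N by move=> v vU; rewrite degH.
have sumH : (\sum_(v in U) degree H v <= b.+1 * (a + k) + a.-1)%N.
  rewrite (eq_bigr _ degH); move: sum_lt; rewrite cU; clear - ha ja; lia.
have L_le : (#|T| - b - 2)%:R <= spectral_radius H R.
  apply: le_trans GH; apply: le_trans r_ge; rewrite !natrB //; lia.
have r1 : 2 * (a + k + a.-1)%:R < spectral_radius H R.
  by apply: lt_le_trans L_le; rewrite -natrM ltr_nat.
have r2 : 2 * (a + k + a.-1)%:R * (b.+1 * (a + k) + a.-1)%:R <
    spectral_radius H R * (spectral_radius H R + 1).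
  set L := (#|T| - b - 2)%N in L_le large1 large2.
  apply: (@lt_le_trans _ _ (L%:R * (L%:R + 1))); last first.
    by apply: ler_pM => //; rewrite ?lerD2r // addr_ge0.
  rewrite natr1 -!natrM ltr_nat.
  by apply: leq_ltn_trans (leq_mul (ltnW large1) large2) _; rewrite ltn_pmul2l //; lia.
have extF A A' v1 : extremal_data U (a + k) a.-1 A A' v1 ->
    spectral_radius (extremal_graph U A A' v1) R <= spectral_radius (F_graph #|T| a b k) R.
  move=> data; have [g [g' gK g'K] Fg] := F_graph_extremal ha cU data.
  apply: (@spectral_radius_mono R _ _ _ _ g') => //; first by exists g.
  by move=> x y; rewrite Fg !g'K.
have r_max A A' v1 : extremal_data U (a + k) a.-1 A A' v1 ->
    spectral_radius (extremal_graph U A A' v1) R <= spectral_radius H R.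
  by move=> /extF le_F; apply: le_trans GH; apply: le_trans hlam.
have clH := @completion_clique T G U.
have [A [A' [v1 [data HE]]]] := extremality clH cU b0 D0 DE degHD sumH r1 r2 r_max.
(* The radii form a closed chain: F is at most G, G at most H, and H, being extremal, at most F. *)
have eq_r : spectral_radius G R = spectral_radius H R.
  apply/eqP; rewrite eq_le GH /=; apply: le_trans hlam; apply: le_trans (extF _ _ _ data).
  by apply: (@spectral_radius_mono R _ _ _ _ id) => //; [exists id | move=> x y; rewrite HE].
have [y [y_ge0 y_neq0 eigenG]] := perron_vector R G T0.
have nbsum_le x : nbsum G y x <= nbsum H y x.
  rewrite /nbsum big_mkcond [leRHS]big_mkcond; apply: ler_sum => w _.
  by case: ifP => [/sub_completion ->//|_]; case: ifP.
(* The form of [H] at [y] is at least that of [G], which is already the maximum for [H]. *)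
have eigenH : forall x, nbsum H y x = spectral_radius H R * y x.
  apply: qform_max_eigen; first exact: qform_le_spectral_radius.
  by rewrite -eq_r -(qform_eigen eigenG); apply: ler_sum => x _; rewrite ler_wpM2l.
have y_gt0 := H_perron_gt0 clH cU D0 degHD sumH r1 r2 y_ge0 y_neq0 eigenH.
have HG x w : H x w = G x w || [&& x \notin U, w \notin U & x != w] by [].
(* An edge added by the completion would end at a clique vertex [w] with a positive entry, and the
   neighbour sums at [x] in [G] and [H] would differ. *)
have GHE x w : G x w = H x w.
  rewrite HG; case: (boolP (G x w)) => // nGxw; apply/esym/negbTE/negP => xw.
  have wU : w \in ~: U by rewrite inE; case/and3P: xw.
  have Hxw : H x w by rewrite HG (negbTE nGxw).
  have : nbsum G y x = nbsum H y x by rewrite eigenG eigenH eq_r.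
  rewrite /nbsum big_mkcond [RHS]big_mkcond (bigD1 w) //= [RHS](bigD1 w) //=.
  rewrite (negbTE nGxw) [completion_rel _ _ _ _]Hxw add0r => eq_sum.
  have := y_gt0 w wU.
  have : \sum_(v | v != w) (if G x v then y v else 0) <=
      \sum_(v | v != w) (if completion_rel G U x v then y v else 0).
    by apply: ler_sum => v _; case: ifP => [/(sub_completion U) /= ->//|_]; case: ifP.
  by move: eq_sum; clear; lra.
have [g [g' gK g'K] Fg] := F_graph_extremal ha cU data.
exists g'; first by exists g.
by move=> x w; rewrite Fg !g'K -HE GHE.
Qed.
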